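(* Let $\alpha>0$, $\nu>-1$ and $n\in\mathbb N$. Then for $z\in\mathbb C$ $$\int_{\mathbb C}u^{n+\nu/2}\,I_\nu\left(\frac\alpha2\sqrt{z\overline u}\right)e^{-\frac16\alpha\,\mathrm{Re}\,u}\,K_\nu\left(\frac{\alpha|u|}{3}\right)d\sigma(u)=\frac{(-1)^n\,3\pi\,2^{\nu+3}\,4^n\,n!}{\alpha^{n+2}}\,z^{\nu/2}e^{-\alpha z/4}\,L^\nu_n(\alpha z).$$
   Context: $I_\nu$ is the modified Bessel function of the first kind, $K_\nu$ is the MacDonald function (modified Bessel function of the second kind), $L^\nu_n$ is the (generalized) Laguerre polynomial $L_n^\nu(x)=\sum_{k=0}^n\frac{(-1)^k\,\Gamma(n+\nu+1)}{(n-k)!\,\Gamma(k+\nu+1)\,k!}x^k$, and $d\sigma$ is planar Lebesgue measure on $\mathbb C$. Branches of roots and powers are principal, taken consistently: $\sqrt{z\overline u}=\sqrt z\,\overline{\sqrt u}$, $z^{\nu/2}=(\sqrt z)^\nu$, $u^{\nu/2}=(\sqrt u)^\nu$, and in $I_\nu(w)=w^\nu\cdot(\text{even entire function of }w)$ one takes $(\sqrt z\,\overline{\sqrt u})^\nu=(\sqrt z)^\nu\,\overline{(\sqrt u)^\nu}$ (equivalently, the identity is understood after cancelling $z^{\nu/2}$, where both sides become entire in $z$). *)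

(* Defs.v *)
From mathcomp Require Import all_boot all_order all_algebra.
From mathcomp Require Import all_classical all_reals all_analysis.
From mathcomp Require Import complex.

Set Implicit Arguments.
Unset Strict Implicit.
Unset Printing Implicit Defensive.

Import Order.TTheory GRing.Theory Num.Theory.
Import numFieldNormedType.Exports.

Local Open Scope classical_set_scope.
Local Open Scope ring_scope.
Local Open Scope complex_scope.

Section RealFunctions.
Context {R : realType}.
Implicit Types nu x s t : R.

(* Euler's integral; it is only used at s > 0. *)
Definition Gamma s : R :=
  \int[lebesgue_measure]_(t in `]0, +oo[) (t `^ (s - 1) * expR (- t)).

Definition cosh t : R := (expR t + expR (- t)) / 2.

(* The MacDonald function at x > 0, as the convergent integral
   K_nu(x) = \int_0^oo e^(- x cosh t) cosh (nu t) dt. *)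
Definition besselK nu x : R :=
  \int[lebesgue_measure]_(t in `[0, +oo[) (expR (- x * cosh t) * cosh (nu * t)).

End RealFunctions.

Section ComplexFunctions.
Context {R : realType}.
Implicit Types (nu s : R) (z w : R[i]).

Local Notation cabs := ComplexField.Normc.normc.

(* Principal argument, with values in ]-pi, pi]; the value at 0 is
   irrelevant. *)
Definition carg z : R :=
  if 0 <= complex.Im z then acos (complex.Re z / cabs z) else - acos (complex.Re z / cabs z).

Definition cexp z : R[i] :=
  (expR (complex.Re z) * cos (complex.Im z)) +i* (expR (complex.Re z) * sin (complex.Im z)).

(* Principal power z^s with a real exponent s.  At z = 0 it is 0 if s != 0, and
   1 if s = 0 (the convention of powR).  The principal square root is the
   library's sqrtc. *)
Definition cpow z s : R[i] :=
  (cabs z `^ s * cos (s * carg z)) +i* (cabs z `^ s * sin (s * carg z)).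

Definition cseries (c : nat -> R[i]) : R[i] :=
  limn (series (fun k => complex.Re (c k))) +i* limn (series (fun k => complex.Im (c k))).

(* The even entire function w |-> (w/2)^(- nu) I_nu(w). *)
Definition besselI_even nu w : R[i] :=
  cseries (fun k => (w / 2) ^+ (2 * k) / (k`!%:R * Gamma (k%:R + nu + 1))%:C).

(* I_nu with the principal branch of the power.  At w = a sqrt z (sqrt u)^* with
   a > 0 and principal square roots, the arguments of sqrt z and (sqrt u)^* lie
   in ]-pi/2, pi/2] and [-pi/2, pi/2[, so that their sum lies in ]-pi, pi[ and
   the principal w^nu is a^nu (sqrt z)^nu ((sqrt u)^nu)^*. *)
Definition besselI nu w : R[i] := cpow (w / 2) nu * besselI_even nu w.

Definition laguerre (n : nat) nu z : R[i] :=
  \sum_(k < n.+1)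
    ((-1) ^+ k * Gamma (n%:R + nu + 1) /
     ((n - k)`!%:R * Gamma (k%:R + nu + 1) * k`!%:R))%:C * z ^+ k.

(* Planar Lebesgue measure, on the pairs (x, y) standing for x + iy. *)
Definition planar_measure :
    {measure set (measurableTypeR R * measurableTypeR R) -> \bar R} :=
  (lebesgue_measure \x lebesgue_measure)%E.

Definition cintegrable (f : R[i] -> R[i]) : Prop :=
  planar_measure.-integrable setT (fun p => (complex.Re (f (p.1 +i* p.2)))%:E) /\
  planar_measure.-integrable setT (fun p => (complex.Im (f (p.1 +i* p.2)))%:E).

Definition cintegral (f : R[i] -> R[i]) : R[i] :=
  (\int[planar_measure]_p complex.Re (f (p.1 +i* p.2))) +i*
  (\int[planar_measure]_p complex.Im (f (p.1 +i* p.2))).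

End ComplexFunctions.

(* Main.v *)
Require Import Defs.
From HB Require Import structures.
From mathcomp Require Import all_boot all_order all_algebra.
From mathcomp Require Import all_classical all_reals all_analysis.
From mathcomp Require Import complex.
From mathcomp Require Import measurable_realfun ring lra.

Set Implicit Arguments.
Unset Strict Implicit.
Unset Printing Implicit Defensive.

Import Order.TTheory GRing.Theory Num.Theory.
Import numFieldNormedType.Exports.

Local Open Scope classical_set_scope.
Local Open Scope ring_scope.
Local Open Scope complex_scope.

(** The substitution t = theta - ln (x / 2) turns the integral of K_nu into
    x^nu K_nu(x) = 2^(nu - 1) \int e^(nu theta - e^theta - (x^2 / 4) e^(- theta)) dtheta,
    so that |u|^nu K_nu(alpha |u| / 3) is a mixture of Gaussians in u.  The
    branches of u^(n + nu/2) and of I_nu combine, up to the factor z^(nu/2),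
    into the power series of I_nu in z \bar u times u^n |u|^nu.  Term by term
    one needs the planar moments of u^n \bar u^k against a Gaussian shifted by
    e^(- alpha Re u / 6); integration by parts makes them polynomials in
    e^theta, and the remaining integral over theta is a combination of Gamma
    values.  The resulting power series in z is the product of e^(- alpha z / 4)
    with the Laguerre polynomial.  Dominated convergence needs only
    e^(2 alpha |u| / 9) K_nu(alpha |u| / 3), whose exponent stays below
    alpha / 3. *)

(** All constants come from one completed square. At fixed [theta] the planar Gaussian has
    [c = alpha^2 / 36 * e^(- theta)] and linear term [b = alpha / 6], so its mean is
    [- 3 / alpha * e^theta], and [b^2 / (4 c) = e^theta / 4] lowers the exponent [e^theta] to
    [3 / 4 * e^theta]. The Gamma integral then contributes [4 / 3] per power, and [(alpha / 4)^2 *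
    (- 3 / alpha) * (4 / 3) = - alpha / 4] is the rate of the exponential in the answer. What
    remains of the coefficient of [z^k] is a sum of products of [k^_j] with a rising factorial that
    also depends on [k]. Rewritten in the falling factorials [k^_j] alone it can be summed, because
    [k^_j s^k / k!] sums to [s^j e^s]; the new coefficients are those of the Laguerre polynomial.
    The domination is a budget of exponential rates in [|u|]: [alpha / 6] for the explicit
    exponential and [alpha / 36] each for [u^n] and for the series of I_nu, which grows more slowly
    than any exponential. The total is [2 alpha / 9]. *)

(** * Integrals over the real line *)

Section RealLine.
Context {R : realType}.
Notation mu := (@lebesgue_measure R).
Implicit Types (f F G : R -> R) (s x : R).

Lemma integral_split0 f : (forall x, 0 <= f x) -> continuous f ->
  (\int[mu]_x (f x)%:E =
   \int[mu]_(x in `]-oo, 0%R]) (f x)%:E + \int[mu]_(x in `[0%R, +oo[) (f x)%:E)%E.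
Proof.
move=> f0 cf.
have mf : measurable_fun setT f by exact: continuous_measurable_fun.
rewrite -{1}(setUv `]-oo, 0%R]%classic) setCitvl ge0_integral_setU//=.
- rewrite integral_itv_obnd_cbnd//.
  by apply/measurable_EFinP/measurable_funTS.
- by apply/measurable_EFinP; rewrite -setCitvl setUv.
- by move=> x _; rewrite lee_fin.
- rewrite disj_set2E; apply/eqP; rewrite -subset0 => x []/= /[!in_itv]/=.
  by rewrite andbT leNgt => /negP.
Qed.

Lemma integral_reflection f : (forall x, 0 <= f x) -> continuous f ->
  (\int[mu]_x (f (- x))%:E = \int[mu]_x (f x)%:E)%E.
Proof.
move=> f0 cf.
have cfN : continuous (f \o -%R).
  by move=> x; apply: continuous_comp; [exact: continuousN|exact: cf].
rewrite (integral_split0 f0 cf) (@integral_split0 (f \o -%R))//; last first.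
  by move=> x /=.
have := @ge0_integration_by_substitutionNy _ f 0; rewrite oppr0 => ->; first last.
- by move=> x _.
- exact: continuous_subspaceT.
have := @ge0_integration_by_substitutionNy _ (f \o -%R) 0; rewrite oppr0 => ->; first last.
- by move=> x _ /=.
- exact: continuous_subspaceT.
rewrite addeC; congr (_ + _)%E.
by apply: eq_integral => x _ /=; rewrite opprK.
Qed.

Lemma integral_affine f (l t : R) : 0 < l -> (forall x, 0 <= f x) ->
  continuous f ->
  (\int[mu]_x (f x)%:E = \int[mu]_x (f (l * x + t) * l)%:E)%E.
Proof.
move=> l0 f0 cf.
pose F := fun x : R => l * x + t.
have F' x : is_derive x 1 F l.
  rewrite /F; apply: is_derive_eq.
  by rewrite scaler1 addr0.
have F'E : derive1 F = fun=> l.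
  by apply/funext => x; rewrite derive1E; apply: derive_val.
rewrite (@increasing_ge0_integration_by_substitutionT R F f) ?F'E//.
- by move=> x y xy; rewrite /F ltrD2r ltr_pM2l.
- by move=> x; exact: cvg_cst.
- exact: is_cvg_cst.
- exact: is_cvg_cst.
- rewrite /F; apply/cvgrNyPle => A; exists ((A - t) / l); split; first exact: num_real.
  by move=> x xA; rewrite -lerBrDr mulrC -ler_pdivlMr// ltW.
- rewrite /F; apply/cvgryPge => A; exists ((A - t) / l); split; first exact: num_real.
  by move=> x xA; rewrite -lerBlDr mulrC -ler_pdivrMr// ltW.
Qed.

(** By evenness the integral reduces to [[0, +oo[], where the exponential density [s * e^(- s x)]
    has total mass 1. *)
Lemma integrable_expabs s : 0 < s ->
  mu.-integrable [set: R] (EFin \o (fun x : R => expR (- (s * `|x|)))).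
Proof.
move=> s0.
have cE : continuous (fun x : R => expR (- (s * `|x|))).
  move=> x; apply: continuous_comp; last exact: continuous_expR.
  apply: continuousN; apply: continuousM; first exact: cvg_cst.
  exact: norm_continuous.
apply/integrableP; split.
  by apply/measurable_EFinP; exact: continuous_measurable_fun.
under eq_integral do rewrite /= ger0_norm ?expR_ge0//.
rewrite ge0_symfun_integralT//; last by move=> x /=; rewrite normrN.
rewrite (_ : [set x | _] = `[0, +oo[%classic); last first.
  by apply/seteqP; split => x/=; rewrite in_itv/= andbT.
have := integral_exponential_pdf s0.
rewrite [X in X = _ -> _](_ : _ = \int[mu]_x
    ((EFin \o (fun x => s * expR (- s * x))%R) \_ `[0%R, +oo[) x)%E; last first.
  by rewrite restrict_EFin.
rewrite -integral_mkcond/=.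
under eq_integral do rewrite EFinM.
have mE : measurable_fun (`[0%R, +oo[%classic : set R) (fun x : R => expR (- s * x)).
  apply: measurable_funTS; apply: continuous_measurable_fun => x.
  apply: continuous_comp; last exact: continuous_expR.
  by apply: continuousM; [exact: cvg_cst|exact: cvg_id].
rewrite ge0_integralZl//=; [|by apply/measurable_EFinP|by rewrite lee_fin ltW].
move=> Hs; under eq_integral.
  move=> x /=; rewrite inE/= in_itv/= andbT => x0.
  rewrite ger0_norm// -mulNr.
  over.
rewrite muleC lte_mul_pinfty//.
- by apply: integral_ge0 => x _; rewrite lee_fin expR_ge0.
(* Finiteness is read off [Hs]: an infinite integral times [s > 0] could not equal 1. *)
- rewrite fin_numE; apply/andP; split; apply/eqP => abs; move: Hs; rewrite abs.
  + by rewrite mulrNy gtr0_sg// mul1e.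
  + by rewrite mulry gtr0_sg// mul1e.
- by rewrite ltry.
Qed.

Lemma integrable_le_expabs f C s : 0 < s -> continuous f ->
  (forall x, `|f x| <= C * expR (- (s * `|x|))) ->
  mu.-integrable [set: R] (EFin \o f).
Proof.
move=> s0 cf fC.
have iE := @integrableZl _ _ _ mu [set: R] measurableT C _ (integrable_expabs s0).
apply: le_integrable iE => //.
- by apply/measurable_EFinP; exact: continuous_measurable_fun.
- move=> x _ /=; rewrite lee_fin (le_trans (fC x))//.
  exact: ler_norm.
Qed.

Lemma cvg_expabs_nat s (u : R^nat) : 0 < s -> (forall n, `|u n| = n.+1%:R) ->
  expR (- (s * `|u n|)) @[n --> \oo] --> (0 : R).
Proof.
move=> s0 uE.
apply: (@squeeze_cvgr _ _ _ _ (fun=> 0) (fun n => s^-1 * harmonic n)).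
- near=> n; rewrite expR_ge0/= uE expRN -invfM lef_pV2 ?posrE ?expR_gt0//.
  + by apply: le_trans (expR_ge1Dx _); rewrite lerDr.
  + by rewrite mulr_gt0.
- exact: cvg_cst.
- by rewrite -(mulr0 s^-1); apply: cvgMr; exact: cvg_harmonic.
Unshelve. all: by end_near. Qed.

(** The fundamental theorem of calculus on [[- (n + 1), n + 1]]: the boundary values vanish in the
    limit by the bound on [F], and the truncated integrals converge to the full one by dominated
    convergence. The integrations by parts for Gamma and for the Gaussian moments are instances,
    with [F] the function to be differentiated. *)
Lemma integral_derive_expabs F f C s : 0 < s -> continuous f ->
  (forall x, is_derive x 1 F (f x)) ->
  (forall x, `|F x| <= C * expR (- (s * `|x|))) ->
  (forall x, `|f x| <= C * expR (- (s * `|x|))) ->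
  \int[mu]_x f x = 0.
Proof.
move=> s0 cf F' FC fC.
have fi := integrable_le_expabs s0 cf fC.
have cF : continuous F.
  move=> x; apply/differentiable_continuous/derivable1_diffP.
  by have [] := F' x.
pose g n := f \_ `[- n.+1%:R, n.+1%:R].
have mf : measurable_fun setT f by exact: continuous_measurable_fun.
have mg n : measurable_fun setT (EFin \o g n).
  by apply/measurable_EFinP; apply/measurable_restrict => //; exact: measurable_funTS.
have [_ _ Hcvg] : [/\ mu.-integrable [set: R] (EFin \o f),
  [sequence \int[mu]_x (`|(EFin \o g n) x - (EFin \o f) x|)]_n @ \oo --> 0%E &
  [sequence \int[mu]_x ((EFin \o g n) x)]_n @ \oo --> \int[mu]_x ((EFin \o f) x)]%E.
  apply: (@dominated_convergence _ _ _ mu setT measurableT (fun n => EFin \o g n) (EFin \o f) (abse \o (EFin \o f))) => //.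
  - by apply/measurable_EFinP.
  - apply: aeW => x _; apply/fine_cvgP; split; first by near=> n.
    have [N xN] : exists N : nat, `|x| <= N%:R.
      exists (Num.bound `|x|); apply: ltW; apply: archi_boundP; exact: normr_ge0.
    apply: cvg_near_cst; exists N => //= n Nn.
    rewrite /= /g patchE ifT// inE/= in_itv/= -ler_norml (le_trans xN)// ler_nat.
    exact: leq_trans Nn _.
  - by apply: integrable_abse.
  - apply: aeW => x n _ /=; rewrite /g patchE; case: ifPn => // _.
    by rewrite normr0 lee_fin.
have H0 n : (\int[mu]_x ((EFin \o g n) x) = (F n.+1%:R - F (- n.+1%:R))%:E)%E.
  rewrite /g -restrict_EFin -integral_mkcond/= (@continuous_FTC2 _ f F).
  - by rewrite EFinB.
  - by rewrite (@lt_trans _ _ 0)// oppr_lt0.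
  - exact: continuous_subspaceT.
  - split.
    + by move=> x _; have [] := F' x.
    + by apply: cvg_at_right_filter; exact: cF.
    + by apply: cvg_at_left_filter; exact: cF.
  - by move=> x _; rewrite derive1E; have [_ ->] := F' x.
have H1 : (F n.+1%:R - F (- n.+1%:R)) @[n --> \oo] --> (0 : R).
  have tend u : (forall n, `|u n| = n.+1%:R) -> F (u n) @[n --> \oo] --> (0 : R).
    move=> uE; apply/cvgr0Pnorm_le => e e0.
    have HC : `|C| * expR (- (s * `|u n|)) @[n --> \oo] --> (0 : R).
      rewrite -(mulr0 `|C|); apply: cvgMr; exact: cvg_expabs_nat.
    near=> n; apply: (le_trans (FC _)).
    apply: (@le_trans _ _ (`|C| * expR (- (s * `|u n|)))).
      by rewrite ler_wpM2r ?expR_ge0// ler_norm.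
    near: n; move/cvgr0Pnorm_le : HC => /(_ _ e0); apply: filterS => n.
    exact: le_trans (ler_norm _).
  rewrite -[X in _ --> X]subr0; apply: cvgB; apply: tend => n.
    by rewrite normr_nat.
  by rewrite normrN normr_nat.
have H2 : (\int[mu]_x (f x)%:E = 0)%E.
  have H1E : ((F n.+1%:R - F (- n.+1%:R))%:E @[n --> \oo] --> 0)%E.
    by apply: cvg_EFin; [near=> n|exact: H1].
  apply: (cvg_unique _ _ H1E) => //.
  apply: cvg_trans Hcvg; apply: near_eq_cvg; near=> n.
  by rewrite /= -H0.
by rewrite /Rintegral H2.
Unshelve. all: by end_near. Qed.

End RealLine.

(** * Gamma and K_nu as integrals of double exponentials *)

(** An instance, so that [is_derive_eq] differentiates exponentials of composite expressions by
    inference. *)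
#[export] Instance is_derive_expR_comp (R : realType) (g : R -> R) (x dg : R) :
  is_derive x 1 g dg -> is_derive x 1 (fun y => expR (g y)) (dg * expR (g x)).
Proof.
move=> gx.
have := @is_derive1_comp _ expR g x (expR (g x)) dg (is_derive_expR _) gx.
by rewrite mulrC.
Qed.

Lemma continuous_is_derive (R : realType) (f g : R -> R) :
  (forall x : R, is_derive x (1 : R) f (g x)) -> continuous f.
Proof.
move=> f' x; apply/differentiable_continuous/derivable1_diffP.
by have [] := f' x.
Qed.

Section ExpExp.
Context {R : realType}.
Notation mu := (@lebesgue_measure R).
Implicit Types (s l th : R).

Lemma is_derive_expexp s l th :
  is_derive th 1 (fun th => expR (s * th - l * expR th))
    ((s - l * expR th) * expR (s * th - l * expR th)).
Proof.
apply: is_derive_eq.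
by rewrite scaler1.
Qed.

Lemma continuous_expexp s l : continuous (fun th : R => expR (s * th - l * expR th)).
Proof. exact: continuous_is_derive (is_derive_expexp s l). Qed.

(** For [th <= 0] the term [l * expR th] is dropped. For [th > 0] it is bounded below by its tangent
    at [t], the point where its slope is [2 * s]: one [s] cancels [s * th], the other is the decay
    that is left. *)
Lemma expexp_le s l : 0 < s -> 0 < l ->
  {C | forall th, expR (s * th - l * expR th) <= C * expR (- (s * `|th|))}.
Proof.
move=> s0 l0; pose t := ln (2 * s / l).
have sl0 : 0 < 2 * s / l by rewrite divr_gt0// mulr_gt0.
exists (1 + expR (2 * s * t - 2 * s)) => th.
have [th0|th0] := leP th 0.
  apply: (@le_trans _ _ (expR (- (s * `|th|)))).
    rewrite ler_expR ler0_norm// mulrN opprK gerBl mulr_ge0// ?expR_ge0//.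
    exact: ltW.
  by rewrite ler_peMl ?expR_ge0// lerDl expR_ge0.
apply: (@le_trans _ _ (expR (2 * s * t - 2 * s) * expR (- (s * `|th|)))); last first.
  by rewrite ler_wpM2r ?expR_ge0// lerDr.
rewrite -expRD ler_expR gtr0_norm//.
have -> : expR th = expR t * expR (th - t) by rewrite -expRD addrC subrK.
rewrite lnK ?posrE//.
have h : 2 * s * (1 + (th - t)) <= 2 * s * expR (th - t).
  by rewrite ler_pM2l ?mulr_gt0// expR_ge1Dx.
rewrite mulrA (_ : l * (2 * s / l) = 2 * s); last first.
  by rewrite mulrC divfK// gt_eqF.
lra.
Qed.

Lemma integrable_expexp s l : 0 < s -> 0 < l ->
  mu.-integrable [set: R] (EFin \o (fun th : R => expR (s * th - l * expR th))).
Proof.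
move=> s0 l0; have [C HC] := expexp_le s0 l0.
apply: (@integrable_le_expabs _ _ C s) => //; first exact: continuous_expexp.
by move=> th; rewrite ger0_norm ?expR_ge0.
Qed.

(** The substitution [t = e^th]. It is made on the compact intervals [A n] and [B n], which exhaust
    the two domains, and monotone convergence carries it over. *)
Lemma integral_Gamma s :
  (\int[mu]_(t in `]0%R, +oo[) (t `^ (s - 1) * expR (- t))%:E =
   \int[mu]_th (expR (s * th - expR th))%:E)%E.
Proof.
pose f := fun t : R => t `^ (s - 1) * expR (- t).
pose h := fun th : R => expR (s * th - expR th).
have ch : continuous h.
  move=> x; have := @continuous_expexp s 1 x.
  by rewrite /h; under [X in _ -> {for _, continuous X}]eq_fun do rewrite -[expR _ in X in _ - X]mul1r.
have mh : measurable_fun setT h by exact: continuous_measurable_fun.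
have cf : {in `]0, +oo[, continuous f}.
  move=> x; rewrite in_itv/= andbT => x0; have c1 : {for x, continuous (fun t : R => t `^ (s - 1))}.
    apply/differentiable_continuous/derivable1_diffP.
    by apply: derivable_powR; rewrite in_itv/= andbT.
  apply: cvgM; first exact: c1.
  by apply: continuous_comp; [exact: opp_continuous|exact: continuous_expR].
have mf : measurable_fun (`]0%R, +oo[ : set R) f.
  by apply: open_continuous_measurable_fun => // x; rewrite inE; exact: cf.
pose A n := `[expR (- n%:R), expR n%:R]%classic : set R.
pose B n := `[- n%:R, n%:R]%classic : set R.
have UA : \bigcup_n A n = `]0%R, +oo[%classic.
  apply/seteqP; split => [x [n _]|x]; rewrite /A /= !in_itv/=.
    by move=> /andP[+ _]; rewrite andbT; apply: lt_le_trans; exact: expR_gt0.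
  rewrite andbT => x0; exists (Num.bound `|ln x|) => //=.
  have /andP[lx1 lx2] : - (Num.bound `|ln x|)%:R <= ln x <= (Num.bound `|ln x|)%:R.
    by rewrite -ler_norml ltW//; apply: archi_boundP; exact: normr_ge0.
  rewrite /A /= in_itv/=; apply/andP; split.
    by rewrite -[leRHS]lnK ?posrE// ler_expR.
  by rewrite -[leLHS]lnK ?posrE// ler_expR.
have UB : \bigcup_n B n = setT.
  apply/seteqP; split => // x _; exists (Num.bound `|x|) => //=.
  rewrite /B /= in_itv/= -ler_norml ltW//.
  by apply: archi_boundP; exact: normr_ge0.
have ndA : nondecreasing_seq A.
  move=> m n mn; rewrite subsetEset; apply: subset_itvScc; rewrite bnd_simp ler_expR ?lerN2 ler_nat//.
have ndB : nondecreasing_seq B.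
  move=> m n mn; rewrite subsetEset; apply: subset_itvScc; rewrite bnd_simp ?lerN2 ler_nat//.
have mA n : measurable (A n) by rewrite /A.
have mB n : measurable (B n) by rewrite /B.
have mfA n : measurable_fun (A n) (EFin \o f).
  apply/measurable_EFinP; apply: measurable_funS mf => //.
  by rewrite -UA; exact: bigcup_sup.
have mhB n : measurable_fun (B n) (EFin \o h).
  by apply/measurable_EFinP; exact: measurable_funTS.
have f0 n x : A n x -> (0 <= (EFin \o f) x)%E.
  by move=> _; rewrite lee_fin mulr_ge0// ?powR_ge0 ?expR_ge0.
have h0 n x : B n x -> (0 <= (EFin \o h) x)%E by rewrite lee_fin expR_ge0.
have h1 := ge0_nondecreasing_set_cvg_integral (mu := mu) ndA mA mfA f0.
have h2 := ge0_nondecreasing_set_cvg_integral (mu := mu) ndB mB mhB h0.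
have AB n : (\int[mu]_(x in A n) (f x)%:E = \int[mu]_(x in B n) (h x)%:E)%E.
  have dE : derive1 (@expR R) = expR.
    by apply/funext => x; rewrite derive1E; apply: derive_val.
  rewrite /A (@integration_by_substitution_increasing _ expR f); last first.
  - apply: continuous_in_subspaceT => x; rewrite inE/= in_itv/= => /andP[x0 _].
    by apply: cf; rewrite in_itv/= andbT (lt_le_trans _ x0)// expR_gt0.
  - split => [x _||]; first exact: derivable_expR.
      by apply: cvg_at_right_filter; exact: continuous_expR.
    by apply: cvg_at_left_filter; exact: continuous_expR.
  - rewrite dE; apply/cvg_ex; eexists.
    by apply: cvg_at_left_filter; exact: continuous_expR.
  - rewrite dE; apply/cvg_ex; eexists.
    by apply: cvg_at_right_filter; exact: continuous_expR.
  - by rewrite dE => x _; exact: continuous_expR.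
  - by move=> x y _ _; rewrite ltr_expR.
  - by rewrite (@le_trans _ _ 0)// ?oppr_le0.
  rewrite dE; apply: eq_integral => x _ /=.
  have -> : ((f \o expR) * expR) x = f (expR x) * expR x by [].
  rewrite /f /h; congr EFin; rewrite -expRM mulrAC -expRD -expRD; congr expR.
  by rewrite mulrBr mulr1 subrK mulrC.
rewrite -UB -UA; apply: (cvg_unique _ h1) => //.
have -> : (fun n => \int[mu]_(x in A n) (EFin \o f) x)%E =
  (fun n => \int[mu]_(x in B n) (EFin \o h) x)%E by apply/funext => n; exact: AB.
exact: h2.
Qed.

Lemma GammaE s : Gamma s = \int[mu]_th (expR (s * th - expR th)).
Proof. by rewrite /Gamma /Rintegral integral_Gamma. Qed.

Lemma expexp1 s : (fun th : R => expR (s * th - expR th)) =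
  (fun th => expR (s * th - 1 * expR th)).
Proof. by apply/funext => th; rewrite mul1r. Qed.

Lemma GammaE1 s : Gamma s = \int[mu]_th (expR (s * th - 1 * expR th)).
Proof. by rewrite GammaE expexp1. Qed.

(** In the variable [th] this is integration by parts: the derivative of [e^(s th - e^th)] is [s
    e^(s th - e^th) - e^((s + 1) th - e^th)], and its integral vanishes. *)
Lemma GammaS s : 0 < s -> Gamma (s + 1) = s * Gamma s.
Proof.
move=> s0.
have s10 : 0 < s + 1 by rewrite addr_gt0.
have [C1 HC1] := expexp_le s0 ltr01.
have [C2 HC2] := expexp_le s10 ltr01.
have e1 th : expR ((s + 1) * th - 1 * expR th) = expR th * expR (s * th - 1 * expR th).
  by rewrite -expRD; congr expR; lra.
(* The decay rate [s + 1] is weakened to [s], the common rate for both terms of the derivative. *)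
have HC2' th : expR ((s + 1) * th - 1 * expR th) <= C2 * expR (- (s * `|th|)).
  apply: (le_trans (HC2 th)); rewrite ler_wpM2l//.
    by have := le_trans (expR_ge0 _) (HC2 0); rewrite normr0 mulr0 oppr0 expR0 mulr1.
  by rewrite ler_expR lerN2 ler_wpM2r// lerDl.
have C10 : 0 <= C1.
  by have := le_trans (expR_ge0 _) (HC1 0); rewrite normr0 mulr0 oppr0 expR0 mulr1.
have C20 : 0 <= C2.
  by have := le_trans (expR_ge0 _) (HC2' 0); rewrite normr0 mulr0 oppr0 expR0 mulr1.
have := @integral_derive_expabs R _ _ (C1 + s * C1 + C2) s s0 _ (is_derive_expexp s 1).
have cs := @continuous_expexp s 1.
have cS := @continuous_expexp (s + 1) 1.
have e2 : (fun x => (s - 1 * expR x) * expR (s * x - 1 * expR x)) =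
  (fun x => s * expR (s * x - 1 * expR x) - expR ((s + 1) * x - 1 * expR x)).
  by apply/funext => x; rewrite e1; ring.
rewrite e2 => H.
have {}H := H _ _ _.
rewrite !GammaE1.
have i1 := integrable_expexp s0 ltr01.
have i2 := integrable_expexp s10 ltr01.
move: H; rewrite RintegralB//; last exact: (@integrableZl _ _ _ mu [set: R] measurableT s _ i1).
rewrite RintegralZl// => H; apply/esym/eqP; rewrite -subr_eq0; apply/eqP; apply: H.
- move=> x; apply: cvgB; last exact: cS.
  by apply: cvgM; [exact: cvg_cst|exact: cs].
- move=> x; rewrite ger0_norm ?expR_ge0// (le_trans (HC1 x))//.
  by rewrite ler_wpM2r ?expR_ge0// -addrA lerDl addr_ge0// mulr_ge0// ltW.
- move=> x; have := congr1 (fun h => h x) e2 => /= ->.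
  apply: (le_trans (ler_normB _ _)).
  have s0' := ltW s0.
  rewrite (@ger0_norm _ (s * _)) ?mulr_ge0 ?expR_ge0// ger0_norm ?expR_ge0//.
  have h1 : 0 <= s * (C1 * expR (- (s * `|x|)) - expR (s * x - 1 * expR x)).
    by rewrite mulr_ge0 ?subr_ge0.
  have h2 : 0 <= C1 * expR (- (s * `|x|)) by rewrite mulr_ge0 ?expR_ge0.
  have h3 := HC2' x.
  lra.
Qed.

Lemma Gamma_gt0 s : 0 < s -> 0 < Gamma s.
Proof.
move=> s0; rewrite GammaE1.
have i1 := integrable_expexp s0 ltr01.
have mE : measurable_fun [set: R] (fun th : R => expR (s * th - 1 * expR th)).
  by apply: continuous_measurable_fun; exact: continuous_expexp.
rewrite /Rintegral fine_gt0//; apply/andP; split; last first.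
  exact: (integrable_lty measurableT i1).
(* On [[0, 1]] the integrand is at least the constant [e^(- e)]. *)
apply: (@lt_le_trans _ _ (\int[mu]_(x in `[0%R, 1%R]) (expR (- expR 1))%:E)%E).
  by rewrite integral_cst//= lebesgue_measure_itv/= lte_fin ltr01 oppr0 adde0 mule1 lte_fin expR_gt0.
apply: (@le_trans _ _ (\int[mu]_(x in `[0%R, 1%R]) (expR (s * x - 1 * expR x))%:E)%E).
  apply: ge0_le_integral => //.
  - by apply/measurable_EFinP; exact: measurable_funTS.
  - move=> x /=; rewrite in_itv/= => /andP[x0 x1]; rewrite lee_fin ler_expR mul1r.
    rewrite (@le_trans _ _ (- expR x))// ?lerN2 ?ler_expR//.
    by rewrite lerDr mulr_ge0// ltW.
apply: ge0_subset_integral => //.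
by apply/measurable_EFinP.
Qed.

(** Translating [th] by [ln l] turns [expR th] into [l * expR th], at the price of the factor
    [l^s]. *)
Lemma integral_expexp s l : 0 < s -> 0 < l ->
  \int[mu]_th (expR (s * th - l * expR th)) = l `^ (- s) * Gamma s.
Proof.
move=> s0 l0.
rewrite GammaE /Rintegral (@integral_affine _ (fun th => expR (s * th - expR th)) 1 (ln l))//.
  under [X in _ * fine X]eq_integral.
    move=> x _; rewrite mul1r mulr1 (_ : _ - _ = s * ln l + (s * x - l * expR x)); last first.
      by rewrite expRD lnK ?posrE//; ring.
    rewrite expRD (mulrC s (ln l)) expRM lnK ?posrE// EFinM.
    over.
  rewrite -[X in X = _]/(Rintegral mu setT _) -[X in _ = _ * X]/(Rintegral mu setT (fun x => l `^ s * expR (s * x - l * expR x))).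
  rewrite RintegralZl//; last exact: integrable_expexp.
  by rewrite powRN mulKf// gt_eqF// powR_gt0.
by rewrite expexp1; exact: continuous_expexp.
Qed.

Definition besselK_weight nu y th : R := expR (nu * th - expR th - y * expR (- th)).

Lemma continuous_besselK_weight nu y : continuous (besselK_weight nu y).
Proof.
apply: (@continuous_is_derive _ _ (fun th => (nu - expR th + y * expR (- th)) *
  besselK_weight nu y th)) => th.
rewrite /besselK_weight; apply: is_derive_eq.
by rewrite scaler1 /GRing.scale/= mulN1r mulrN opprK.
Qed.

Lemma besselKE nu (x : R) : 0 < x ->
  x `^ nu * besselK nu x =
  2 `^ nu / 2 * \int[mu]_th besselK_weight nu (x ^+ 2 / 4) th.
Proof.
move=> x0.
pose g (s : R) th := expR (s * th - x * cosh th).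
have cosh_cont : continuous (@cosh R).
  move=> t; rewrite /cosh; apply: cvgM; last exact: cvg_cst.
  apply: cvgD; first exact: continuous_expR.
  by apply: continuous_comp; [exact: opp_continuous|exact: continuous_expR].
have coshN (t : R) : cosh (- t) = cosh t by rewrite /cosh opprK addrC.
have cg s : continuous (g s).
  move=> t; apply: continuous_comp; last exact: continuous_expR.
  apply: continuousB; apply: continuousM; try exact: cvg_cst.
    exact: cvg_id.
  exact: cosh_cont.
have g0 s t : 0 <= g s t by exact: expR_ge0.
have mg s : measurable_fun [set: R] (g s) by exact: continuous_measurable_fun.
have mgE s : measurable_fun [set: R] (fun t => (g s t)%:E) by apply/measurable_EFinP.
(* [cosh (nu * t)] averages [g nu] and [g (- nu)]; as these have equal integrals by reflection, a
   single exponential can take its place. *)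
have gN : (\int[mu]_t (g (- nu) t)%:E = \int[mu]_t (g nu t)%:E)%E.
  rewrite -(@integral_reflection _ (g nu) (g0 nu) (cg nu)); apply: eq_integral => t _.
  by rewrite /g /cosh opprK mulrN mulNr (addrC (expR (- t))).
have gcosh t : expR (- x * cosh t) * cosh (nu * t) = 2^-1 * (g nu t + g (- nu) t).
  rewrite /g {2}/cosh (addrC (nu * t)) (addrC (- nu * t)) !expRD !mulNr; by field.
have H1 : (\int[mu]_(t in `[0%R, +oo[) (expR (- x * cosh t) * cosh (nu * t))%:E =
    (2^-1)%:E * \int[mu]_t (g nu t)%:E)%E.
  have cc : continuous (fun t => expR (- x * cosh t) * cosh (nu * t)).
    have -> : (fun t => expR (- x * cosh t) * cosh (nu * t)) =
        (fun t => 2^-1 * (g nu t + g (- nu) t)) by apply/funext => t; exact: gcosh.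
    move=> t; apply: cvgM; first exact: cvg_cst.
    by apply: cvgD; exact: cg.
  have := @ge0_symfun_integralT R (fun t => expR (- x * cosh t) * cosh (nu * t)) _ cc _.
  rewrite (_ : [set x | _] = `[0, +oo[%classic); last first.
    by apply/seteqP; split => t/=; rewrite in_itv/= andbT.
  move=> sym.
  have {}sym : (\int[mu]_t (expR (- x * cosh t) * cosh (nu * t))%:E =
     2%:E * \int[mu]_(t in `[0%R, +oo[) (expR (- x * cosh t) * cosh (nu * t))%:E)%E.
    apply: sym => t /=.
      by rewrite gcosh mulr_ge0// addr_ge0.
    by rewrite mulrN !coshN.
  have sum : (\int[mu]_t (expR (- x * cosh t) * cosh (nu * t))%:E = \int[mu]_t (g nu t)%:E)%E.
    under eq_integral do rewrite gcosh EFinM EFinD.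
    rewrite ge0_integralZl//=.
    - rewrite ge0_integralD//=.
      + rewrite gN -mule2n muleC -mule_natl.
        rewrite muleC muleA -EFinM mulVf// mul1e//.
      + by move=> t _; rewrite lee_fin.
      + exact: mgE.
      + by move=> t _; rewrite lee_fin.
      + exact: mgE.
    - by apply: emeasurable_funD; exact: mgE.
    - by move=> t _; rewrite adde_ge0// lee_fin.
  by rewrite -sum sym muleA -EFinM mulVf// mul1e.
have H2 : (\int[mu]_t (g nu t)%:E =
    ((2 / x) `^ nu)%:E * \int[mu]_th (besselK_weight nu (x ^+ 2 / 4) th)%:E)%E.
  have mW : measurable_fun [set: R] (fun t => (besselK_weight nu (x ^+ 2 / 4) t)%:E).
    by apply/measurable_EFinP; exact: continuous_measurable_fun (@continuous_besselK_weight nu _).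
  have x20 : 0 < 2 / x by rewrite divr_gt0.
  rewrite (@integral_affine _ (g nu) 1 (ln (2 / x)))//.
  under eq_integral.
    move=> t _; rewrite mul1r mulr1.
    have -> : g nu (t + ln (2 / x)) = (2 / x) `^ nu * besselK_weight nu (x ^+ 2 / 4) t.
      rewrite /g (_ : _ - _ = ln (2 / x) * nu + (nu * t - expR t - x ^+ 2 / 4 * expR (- t))).
        by rewrite expRD expRM lnK ?posrE.
      rewrite /cosh opprD !expRD !expRN lnK ?posrE//.
      by field; rewrite !gt_eqF// expR_gt0.
    rewrite EFinM; over.
  rewrite ge0_integralZl//=.
  - by move=> t _; rewrite lee_fin expR_ge0.
  - by rewrite lee_fin powR_ge0.
rewrite /besselK /Rintegral H1 H2.
set I := (\int[mu]_th _)%E.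
have I0 : (0 <= I)%E by apply: integral_ge0 => t _; rewrite lee_fin expR_ge0.
(* Finiteness of [I] is not at hand here; for positive [a] an infinite [y] makes both sides 0. *)
have fM (a : R) (y : \bar R) : 0 < a -> (0 <= y)%E -> fine (a%:E * y) = a * fine y.
  move=> a0; case: y => [r||]//= _.
  by rewrite mulry gtr0_sg// mul1e/= mulr0.
rewrite !fM ?mule_ge0// ?lee_fin ?powR_ge0// ?powR_gt0 ?divr_gt0//.
rewrite powRM ?invr_ge0// ?ltW// mulrCA mulrA mulrA.
rewrite (_ : x^-1 `^ nu = (x `^ nu)^-1); last by rewrite -powR_inv1 ?ltW// -powRrM mulN1r powRN.
field.
by rewrite gt_eqF// powR_gt0.
Qed.

End ExpExp.

(** * Integrals of products in separate variables *)

Section ProductIntegral.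
Context d1 d2 (T1 : measurableType d1) (T2 : measurableType d2) (R : realType).
Variable m1 : {sigma_finite_measure set T1 -> \bar R}.
Variable m2 : {sigma_finite_measure set T2 -> \bar R}.
Variables (f : T1 -> R) (g : T2 -> R).
Hypothesis fi : m1.-integrable setT (EFin \o f).
Hypothesis gi : m2.-integrable setT (EFin \o g).

Lemma integrable_prodM :
  (m1 \x m2)%E.-integrable setT (EFin \o (fun p => f p.1 * g p.2)).
Proof.
have mf : measurable_fun setT f by apply/measurable_EFinP; exact: measurable_int fi.
have mg : measurable_fun setT g by apply/measurable_EFinP; exact: measurable_int gi.
apply/integrable12ltyP.
  apply/measurable_EFinP; apply: measurable_funM.
    by apply: measurableT_comp.
  by apply: measurableT_comp.
rewrite (_ : (fun x => _) = (fun x => `|f x|%:E * \int[m2]_y `|g y|%:E)%E); last first.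
  apply/funext => x; rewrite -ge0_integralZl//=.
  - by apply: eq_integral => y _; rewrite /= normrM EFinM.
  - by apply/measurable_EFinP; apply: measurableT_comp.
move/integrableP: gi => [_ gi'].
have gfin : (\int[m2]_y `|g y|%:E \is a fin_num)%E.
  by rewrite ge0_fin_numE//; apply: integral_ge0.
rewrite -(fineK gfin) ge0_integralZr//=.
- rewrite lte_mul_pinfty//.
  + by apply: integral_ge0.
  + by rewrite ge0_fin_numE//; [move/integrableP: fi => []|apply: integral_ge0].
  + by rewrite ltry.
- by apply/measurable_EFinP; apply: measurableT_comp.
- by rewrite lee_fin fine_ge0// integral_ge0.
Qed.

Lemma Rintegral_prodM :
  \int[(m1 \x m2)%E]_p (f p.1 * g p.2) = \int[m1]_x f x * \int[m2]_y g y.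
Proof.
rewrite /Rintegral.
have := integral12_prod_meas1 integrable_prodM.
rewrite [X in _ = X -> _](_ : _ = \int[(m1 \x m2)%E]_p (f p.1 * g p.2)%:E)%E// => <-.
have gfin := integrable_fin_num measurableT gi.
have ffin := integrable_fin_num measurableT fi.
rewrite -[RHS]fineM//; congr fine.
rewrite -(fineK gfin) -integralZr//.
apply: eq_integral => x _; rewrite /fubini_F/=.
by rewrite (fineK gfin) -integralZl.
Qed.

End ProductIntegral.

(** * Gaussian moments on the line *)

Section GaussMoments.
Context {R : realType}.
Notation mu := (@lebesgue_measure R).
Implicit Types (b c x : R) (m : nat).

Definition gauss_weight b c x := expR (- b * x - c * x ^+ 2).
Definition gauss_moment b c m := \int[mu]_x (x ^+ m * gauss_weight b c x).

Lemma normX_le_expR x m : `|x| ^+ m <= m`!%:R * expR `|x|.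
Proof.
have h : 0 < m`!%:R :> R by rewrite ltr0n fact_gt0.
case: m h => [|m] h; first by rewrite expr0 fact0 mul1r (le_trans _ (expR_ge1Dx _))// lerDl.
rewrite -ler_pdivrMl// mulrC; apply: le_trans (expR_ge1Dxn m (normr_ge0 x)).
by rewrite lerDr.
Qed.

Lemma gauss_moment_le b c m : 0 < c ->
  {C | forall x, `|x ^+ m * gauss_weight b c x| <= C * expR (- (1 * `|x|))}.
Proof.
move=> c0; exists (m`!%:R * expR ((2 + `|b|) ^+ 2 / (4 * c))) => x.
rewrite normrM normrX /gauss_weight (ger0_norm (expR_ge0 _)).
apply: (@le_trans _ _ (m`!%:R * expR `|x| * expR (- b * x - c * x ^+ 2))).
  by rewrite ler_wpM2r ?expR_ge0// normX_le_expR.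
rewrite -!mulrA ler_wpM2l// -!expRD ler_expR mul1r.
have h1 : - b * x <= `|b| * `|x| by rewrite -normrM mulNr -normrN ler_norm.
(* Completing the square. In the coefficient [2 + |b|] one unit pays for the exponential that bounds
   [x ^+ m], one for the required decay, and [|b|] for the linear term. *)
have h2 : 0 <= c * (`|x| - (2 + `|b|) / (2 * c)) ^+ 2 by rewrite mulr_ge0 ?sqr_ge0// ltW.
have h3 : c * (`|x| - (2 + `|b|) / (2 * c)) ^+ 2 =
   c * x ^+ 2 - (2 + `|b|) * `|x| + (2 + `|b|) ^+ 2 / (4 * c).
  by rewrite -(real_normK (num_real x)); field; rewrite gt_eqF.
rewrite h3 in h2; lra.
Qed.

Lemma is_derive_gauss0 b c x :
  is_derive x (1 : R) (fun x => gauss_weight b c x)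
   (- b * gauss_weight b c x - (2 * c) * (x * gauss_weight b c x)).
Proof.
rewrite /gauss_weight; apply: is_derive_eq.
rewrite /GRing.scale/=; ring.
Qed.

Lemma is_derive_gauss b c m x :
  is_derive x (1 : R) (fun x => x ^+ m.+1 * gauss_weight b c x)
   (m.+1%:R * (x ^+ m * gauss_weight b c x) - b * (x ^+ m.+1 * gauss_weight b c x)
    - (2 * c) * (x ^+ m.+2 * gauss_weight b c x)).
Proof.
have h1 : is_derive x (1 : R) (fun x : R => x ^+ m.+1) (m.+1%:R * x ^+ m).
  have := @is_deriveX R R id m.+1 x 1 1 (is_derive_id _ _).
  by rewrite /GRing.scale/= mulr1 exprfctE.
have h0 := is_derive_gauss0 b c x.
apply: is_derive_eq.
rewrite /GRing.scale/= (exprS _ m.+1) (exprS _ m).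
ring.
Qed.

Lemma continuous_gauss b c m : continuous (fun x => x ^+ m * gauss_weight b c x).
Proof.
have cw := continuous_is_derive (is_derive_gauss0 b c).
by move=> x; apply: cvgM; [exact: exprn_continuous|exact: cw].
Qed.

Lemma integrable_gauss_moment b c m : 0 < c ->
  mu.-integrable [set: R] (EFin \o (fun x : R => x ^+ m * gauss_weight b c x)).
Proof.
move=> c0; have [C HC] := gauss_moment_le b m c0.
exact: (integrable_le_expabs ltr01 (@continuous_gauss b c m) HC).
Qed.

(** The derivative of [x ^+ m * gauss_weight b c x] integrates to 0. At [m = 0] the truncated index
    [m.-1] carries the coefficient 0. *)
Lemma gauss_momentS b c m : 0 < c ->
  m%:R * gauss_moment b c m.-1 =
  b * gauss_moment b c m + 2 * c * gauss_moment b c m.+1.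
Proof.
move=> c0.
have i0 := integrable_gauss_moment b _ c0.
have iZ k j : mu.-integrable [set: R] (EFin \o (fun x : R => k * (x ^+ j * gauss_weight b c x))).
  exact: (@integrableZl _ _ _ mu [set: R] measurableT k _ (i0 j)).
have [C0 HC0] := gauss_moment_le b m.-1 c0.
have [C1 HC1] := gauss_moment_le b m c0.
have [C2 HC2] := gauss_moment_le b m.+1 c0.
pose f x := m%:R * (x ^+ m.-1 * gauss_weight b c x) - b * (x ^+ m * gauss_weight b c x)
    - (2 * c) * (x ^+ m.+1 * gauss_weight b c x).
pose C := C1 + (m%:R * C0 + `|b| * C1 + 2 * c * C2).
have Cge0 C' k : (forall x, `|x ^+ k * gauss_weight b c x| <= C' * expR (- (1 * `|x|))) -> 0 <= C'.
  move=> /(_ 0) /(le_trans (normr_ge0 _)).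
  by rewrite normr0 mulr0 oppr0 expR0 mulr1.
have C00 := Cge0 _ _ HC0; have C10 := Cge0 _ _ HC1; have C20 := Cge0 _ _ HC2.
have c0' := ltW c0.
have H : \int[mu]_x f x = 0.
  apply: (@integral_derive_expabs R (fun x => x ^+ m * gauss_weight b c x) f C 1 ltr01).
  - have cg := @continuous_gauss b c.
    move=> x; apply: cvgB; first apply: cvgB; apply: cvgM; try exact: cvg_cst; exact: cg.
  - move=> x; rewrite /f; case: (m) => [|k]; last exact: is_derive_gauss.
    rewrite (_ : (fun x => _) = gauss_weight b c); last first.
      by apply/funext => y; rewrite expr0 mul1r.
    rewrite mul0r sub0r expr0 expr1 mul1r -mulNr; exact: is_derive_gauss0.
  - move=> x; apply: (le_trans (HC1 x)); rewrite ler_wpM2r ?expR_ge0//.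
    by rewrite lerDl !addr_ge0// mulr_ge0// mulr_ge0.
  - move=> x; rewrite /f.
    apply: (le_trans (ler_normB _ _)); apply: le_trans (lerD (ler_normB _ _) (lexx _)) _.
    rewrite !(normrM _ (_ * gauss_weight _ _ _)) (ger0_norm (ler0n _ _)) (@ger0_norm _ (2 * c)) ?mulr_ge0//.
    have k0 := ler_wpM2l (ler0n R m) (HC0 x).
    have k1 := ler_wpM2l (normr_ge0 b) (HC1 x).
    have k2 : 2 * c * `|x ^+ m.+1 * gauss_weight b c x| <= 2 * c * (C2 * expR (- (1 * `|x|))).
      by rewrite ler_wpM2l// mulr_ge0.
    have k3 : 0 <= C1 * expR (- (1 * `|x|)) by rewrite mulr_ge0// expR_ge0.
    rewrite /C; lra.
move: H; rewrite /f.
have iB : mu.-integrable [set: R] (EFin \o (fun x => m%:R * (x ^+ m.-1 * gauss_weight b c x) - b * (x ^+ m * gauss_weight b c x))).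
  exact: (integrableB measurableT (iZ _ _) (iZ _ _)).
rewrite RintegralB// RintegralB//.
rewrite !RintegralZl// -!/(gauss_moment _ _ _) => H.
lra.
Qed.

(** The affine change [x |-> sqrt c * x + b / (2 * sqrt c)] completes the square and reduces to the
    standard Gaussian integral. *)
Lemma gauss_moment0 b c : 0 < c ->
  gauss_moment b c 0 = Num.sqrt (pi / c) * expR (b ^+ 2 / (4 * c)).
Proof.
move=> c0.
have sc0 : 0 < Num.sqrt c by rewrite sqrtr_gt0.
have scE : Num.sqrt c ^+ 2 = c by rewrite sqr_sqrtr// ltW.
have H := @integralT_gauss R.
rewrite (@integral_affine _ _ (Num.sqrt c) (b / (2 * Num.sqrt c)))// in H; first last.
- exact: continuous_gauss_fun.
- exact: gauss_fun_ge0.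
have e1 x : gauss_fun (Num.sqrt c * x + b / (2 * Num.sqrt c)) * Num.sqrt c =
    Num.sqrt c * expR (- (b ^+ 2 / (4 * c))) * (x ^+ 0 * gauss_weight b c x).
  rewrite expr0 mul1r /gauss_fun /gauss_weight mulrC -mulrA -expRD; congr (_ * expR _).
  by rewrite -scE sqrtr_sqr gtr0_norm//; field; rewrite gt_eqF.
have H' : \int[mu]_x (Num.sqrt c * expR (- (b ^+ 2 / (4 * c))) * (x ^+ 0 * gauss_weight b c x)) = Num.sqrt pi.
  rewrite /Rintegral; under eq_integral do rewrite -e1.
  by rewrite H.
move: H'; rewrite RintegralZl//; last exact: integrable_gauss_moment.
rewrite -/(gauss_moment b c 0) => H'.
rewrite sqrtrM ?pi_ge0// -H' sqrtrV ?ltW// expRN.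
by field; rewrite !gt_eqF// expR_gt0.
Qed.

End GaussMoments.

(** * The recursion for planar Gaussian moments *)

(* [T i j k l] stands for the integral of z^i \bar z^j x^k y^l against
   e^(- b x - c |z|^2); [T_x] and [T_y] are integrations by parts. *)
Section SteinRecursion.
Variables (F : comNzRingType) (im b c : F).
Hypothesis im2 : im * im = - 1.
Variable T : nat -> nat -> nat -> nat -> F.
Hypothesis T_z : forall i j k l, T i.+1 j k l = T i j k.+1 l + im * T i j k l.+1.
Hypothesis T_zbar : forall i j k l, T i j.+1 k l = T i j k.+1 l - im * T i j k l.+1.
Hypothesis T_x : forall k l,
  k%:R * T 0 0 k.-1 l = b * T 0 0 k l + 2 * c * T 0 0 k.+1 l.
Hypothesis T_y : forall k l, l%:R * T 0 0 k l.-1 = 2 * c * T 0 0 k l.+1.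

(** Integration by parts in [x], where [z] and [\bar z] both have derivative 1. Induction on [j],
    then on [i], splits off one factor as [x - im y] or [x + im y] and reduces to [T_x].
    Predecessors of 0 come with the coefficient 0. *)
Lemma moment_dx i j k l :
  i%:R * T i.-1 j k l + j%:R * T i j.-1 k l + k%:R * T i j k.-1 l =
  b * T i j k l + 2 * c * T i j k.+1 l.
Proof.
have h0 j' k' l' : j'%:R * T 0 j'.-1 k' l' + k'%:R * T 0 j' k'.-1 l' =
    b * T 0 j' k' l' + 2 * c * T 0 j' k'.+1 l'.
  elim: j' k' l' => [|j' IH] k' l'; first by rewrite mul0r add0r T_x.
  have e1 := IH k'.+1 l'; have e2 := IH k' l'.+1.
  have h1 : j'%:R * T 0 j' k' l' = j'%:R * T 0 j'.-1 k'.+1 l' - im * (j'%:R * T 0 j'.-1 k' l'.+1).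
    case: (j') => [|m]; first by rewrite !mul0r mulr0 subr0.
    by rewrite T_zbar /=; ring.
  have h2 : k'%:R * T 0 j'.+1 k'.-1 l' = k'%:R * T 0 j' k' l' - im * (k'%:R * T 0 j' k'.-1 l'.+1).
    case: (k') => [|m]; first by rewrite !mul0r mulr0 subr0.
    by rewrite T_zbar /=; ring.
  rewrite h2 !T_zbar -[j'.+1.-1]/j' mulrSr mulrDl mul1r h1.
  rewrite -[k'.+1.-1]/k' mulrSr mulrDl mul1r in e1.
  transitivity (b * T 0 j' k'.+1 l' + 2 * c * T 0 j' k'.+2 l' -
    im * (b * T 0 j' k' l'.+1 + 2 * c * T 0 j' k'.+1 l'.+1)).
    by rewrite -e1 -e2; ring.
  ring.
elim: i k l => [|i IH] k l; first by rewrite mul0r add0r h0.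
have e1 := IH k.+1 l; have e2 := IH k l.+1.
have h1 : i%:R * T i j k l = i%:R * T i.-1 j k.+1 l + im * (i%:R * T i.-1 j k l.+1).
  case: (i) => [|m]; first by rewrite !mul0r mulr0 addr0.
  by rewrite T_z /=; ring.
have h2 : k%:R * T i.+1 j k.-1 l = k%:R * T i j k l + im * (k%:R * T i j k.-1 l.+1).
  case: (k) => [|m]; first by rewrite !mul0r mulr0 addr0.
  by rewrite T_z /=; ring.
rewrite h2 !T_z -[i.+1.-1]/i mulrSr mulrDl mul1r h1.
rewrite -[k.+1.-1]/k mulrSr mulrDl mul1r in e1.
transitivity (b * T i j k.+1 l + 2 * c * T i j k.+2 l +
    im * (b * T i j k l.+1 + 2 * c * T i j k.+1 l.+1)).
  by rewrite -e1 -e2; ring.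
ring.
Qed.

(** The same in [y], where [z] and [\bar z] have derivatives [im] and [- im]; the base case is
    [T_y]. *)
Lemma moment_dy i j k l :
  im * (i%:R * T i.-1 j k l - j%:R * T i j.-1 k l) + l%:R * T i j k l.-1 =
  2 * c * T i j k l.+1.
Proof.
have h0 j' k' l' : - im * (j'%:R * T 0 j'.-1 k' l') + l'%:R * T 0 j' k' l'.-1 =
    2 * c * T 0 j' k' l'.+1.
  elim: j' k' l' => [|j' IH] k' l'; first by rewrite mul0r mulr0 add0r T_y.
  have e1 := IH k'.+1 l'; have e2 := IH k' l'.+1.
  have h1 : j'%:R * T 0 j' k' l' = j'%:R * T 0 j'.-1 k'.+1 l' - im * (j'%:R * T 0 j'.-1 k' l'.+1).
    case: (j') => [|m]; first by rewrite !mul0r mulr0 subr0.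
    by rewrite T_zbar /=; ring.
  have h2 : l'%:R * T 0 j'.+1 k' l'.-1 = l'%:R * T 0 j' k'.+1 l'.-1 - im * (l'%:R * T 0 j' k' l').
    case: (l') => [|m]; first by rewrite !mul0r mulr0 subr0.
    by rewrite T_zbar /=; ring.
  rewrite h2 T_zbar -[j'.+1.-1]/j' mulrSr mulrDl mul1r h1.
  rewrite -[l'.+1.-1]/l' mulrSr mulrDl mul1r in e2.
  transitivity (2 * c * T 0 j' k'.+1 l'.+1 - im * (2 * c * T 0 j' k' l'.+2)).
    by rewrite -e1 -e2; ring.
  ring.
elim: i k l => [|i IH] k l.
  by rewrite mul0r sub0r mulrN -mulNr h0.
have e1 := IH k.+1 l; have e2 := IH k l.+1.
have h1 : i%:R * T i j k l = i%:R * T i.-1 j k.+1 l + im * (i%:R * T i.-1 j k l.+1).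
  case: (i) => [|m]; first by rewrite !mul0r mulr0 addr0.
  by rewrite T_z /=; ring.
have h2 : l%:R * T i.+1 j k l.-1 = l%:R * T i j k.+1 l.-1 + im * (l%:R * T i j k l).
  case: (l) => [|m]; first by rewrite !mul0r mulr0 addr0.
  by rewrite T_z /=; ring.
rewrite h2 !T_z -[i.+1.-1]/i mulrSr mulrDl mul1r h1.
rewrite -[l.+1.-1]/l mulrSr mulrDl mul1r in e2.
transitivity (2 * c * T i j k.+1 l.+1 + im * (2 * c * T i j k l.+2)).
  by rewrite -e1 -e2; ring.
ring.
Qed.

Let N i j := T i j 0 0.

(** The [x]-relation plus [im] times the [y]-relation is integration by parts for the Wirtinger
    derivative [2 d/d\bar z], which ignores powers of [z], so only the factor [j] survives. *)
Lemma moment_z i j : 2 * c * N i.+1 j = 2 * (j%:R * N i j.-1) - b * N i j.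
Proof.
have := moment_dx i j 0 0; have := moment_dy i j 0 0.
rewrite !mul0r !addr0 => e1 e2.
have -> : N i.+1 j = T i j 1 0 + im * T i j 0 1 by rewrite /N T_z.
rewrite mulrDr (mulrCA (2 * c)) -e1.
have -> : 2 * c * T i j 1 0 =
    i%:R * T i.-1 j 0 0 + j%:R * T i j.-1 0 0 - b * T i j 0 0 by rewrite e2; ring.
rewrite (mulrA im im) im2 /N; ring.
Qed.

(** The conjugate relation, from [2 d/dz]. At [i = 0] its lower-order term disappears, and it starts
    the recursion. *)
Lemma moment_zbar i j : 2 * c * N i j.+1 = 2 * (i%:R * N i.-1 j) - b * N i j.
Proof.
have := moment_dx i j 0 0; have := moment_dy i j 0 0.
rewrite !mul0r !addr0 => e1 e2.
have -> : N i j.+1 = T i j 1 0 - im * T i j 0 1 by rewrite /N T_zbar.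
rewrite mulrBr (mulrCA (2 * c)) -e1.
have -> : 2 * c * T i j 1 0 =
    i%:R * T i.-1 j 0 0 + j%:R * T i j.-1 0 0 - b * T i j 0 0 by rewrite e2; ring.
rewrite (mulrA im im) im2 /N; ring.
Qed.

End SteinRecursion.

(** * Binomial sums, falling and rising factorials *)

Section BinomialSums.
Variable F : comNzRingType.

(** Pascal's rule. The complement [n - j] is an argument of [G] in its own right, so that each of
    the two sums is again binomial of order [n], with one argument raised. *)
Lemma sum_binS (G : nat -> nat -> F) n :
  \sum_(j < n.+2) 'C(n.+1, j)%:R * G j (n.+1 - j)%N =
  \sum_(j < n.+1) 'C(n, j)%:R * G j (n - j).+1 +
  \sum_(j < n.+1) 'C(n, j)%:R * G j.+1 (n - j)%N.
Proof.
rewrite big_ord_recl /= bin0.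
under eq_bigr => j _ do rewrite /bump /= add1n binS natrD mulrDl subSS.
rewrite big_split /= addrA; congr (_ + _).
rewrite [RHS]big_ord_recl [X in _ + X = _]big_ord_recr /=.
rewrite bin_small// mul0r addr0 bin0 !subn0; congr (_ + _).
by apply: eq_bigr => j _; rewrite /bump /= add1n subnSK.
Qed.

End BinomialSums.

Section MomentFormula.
Variables (F : comNzRingType) (d q : F) (N : nat -> nat -> F).
Hypothesis N0 : forall k, N 0 k.+1 = d * q * N 0 k.
Hypothesis NS : forall n k,
  N n.+1 k = d * q * N n k + 4 * d ^+ 2 * q * (k%:R * N n k.-1).

(** The mixed moment of order [(n, k)] of a complex Gaussian variable with mean [d q] and variance
    [4 d^2 q], divided by [d^(n + k)]. The index [j] counts pairs of a centred factor with a
    conjugate one; each pair contributes the variance. *)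
Definition moment_poly n k : F :=
  \sum_(j < n.+1) 'C(n, j)%:R * ((k ^_ j)%:R * 4 ^+ j * q ^+ (n - j + k)).

Lemma moment_poly0 k : moment_poly 0 k = q ^+ k.
Proof. by rewrite /moment_poly big_ord1 bin0 ffactn0 expr0 !mul1r subn0. Qed.

Lemma moment_polyS n k :
  moment_poly n.+1 k = q * moment_poly n k + 4 * q * (k%:R * moment_poly n k.-1).
Proof.
rewrite {1}/moment_poly (sum_binS (fun j m => (k ^_ j)%:R * 4 ^+ j * q ^+ (m + k))).
congr (_ + _); rewrite /moment_poly !big_distrr /=; apply: eq_bigr => j _.
  by rewrite addSn (exprS q); ring.
case: k => [|k]; first by rewrite ffact0n !mul0r !mulr0.
by rewrite ffactnS natrM /= addnS !exprS; ring.
Qed.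

Lemma moment_formula n k : N n k = N 0 0 * d ^+ (n + k) * moment_poly n k.
Proof.
elim: n k => [|n IH] k.
  rewrite moment_poly0 add0n; elim: k => [|k IH]; first by rewrite !expr0 !mulr1.
  by rewrite N0 IH !exprS; ring.
rewrite NS !IH moment_polyS addSn (exprS d (n + k)).
case: k => [|k]; first by rewrite /= !mul0r !mulr0 !addr0; ring.
by rewrite addnS (exprS d (n + k)) /=; ring.
Qed.

End MomentFormula.

Section RisingFactorial.
Variable F : comNzRingType.
Implicit Types (x l : F).

Definition rising x n : F := \prod_(i < n) (x + i%:R).

Lemma rising0 x : rising x 0 = 1.
Proof. by rewrite /rising big_ord0. Qed.

Lemma risingS x n : rising x n.+1 = x * rising (x + 1) n.
Proof.
rewrite /rising big_ord_recl /= addr0; congr (_ * _); apply: eq_bigr => i _.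
by rewrite /bump /= natrD; ring.
Qed.

(** A change of basis in [k]: on the left [k] enters both factorials, on the right only [k ^_ j],
    with [l + 1] in place of [l]. Both sides obey the recursion [S (n + 1) k x = (x + k) S n k (x +
    1) + l k S n (k - 1) (x + 1)]. *)
Lemma rising_ffact l n k x :
  \sum_(j < n.+1) 'C(n, j)%:R * (l ^+ j * (k ^_ j)%:R * rising (x + k%:R) (n - j)) =
  \sum_(j < n.+1) 'C(n, j)%:R * ((l + 1) ^+ j * (k ^_ j)%:R * rising (x + j%:R) (n - j)).
Proof.
elim: n k x => [|n IH] k x; first by rewrite !big_ord1 !rising0 !expr0.
pose G1 k x j m := l ^+ j * (k ^_ j)%:R * rising (x + k%:R) m.
pose G2 k x j m := (l + 1) ^+ j * (k ^_ j)%:R * rising (x + j%:R) m.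
rewrite (sum_binS (G1 k x)) (sum_binS (G2 k x)).
pose RH k := \sum_(j < n.+1) 'C(n, j)%:R * G2 k (x + 1) j (n - j)%N.
have e1 : \sum_(j < n.+1) 'C(n, j)%:R * G1 k x j (n - j).+1 = (x + k%:R) * RH k.
  rewrite /RH -IH big_distrr /=; apply: eq_bigr => j _.
  by rewrite /G1 risingS (addrAC x); ring.
have e2 : \sum_(j < n.+1) 'C(n, j)%:R * G1 k x j.+1 (n - j)%N = l * k%:R * RH k.-1.
  rewrite /RH -IH big_distrr /=; apply: eq_bigr => j _.
  rewrite /G1 ffactnS natrM exprS.
  case: k {e1} => [|k]; first by rewrite !mul0r !mulr0 !mul0r mulr0.
  by rewrite /= (_ : x + 1 + k%:R = x + k.+1%:R) ?[k.+1%:R]mulrSr; ring.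
have e3 : \sum_(j < n.+1) 'C(n, j)%:R * G2 k x j.+1 (n - j)%N = (l + 1) * k%:R * RH k.-1.
  rewrite /RH big_distrr /=; apply: eq_bigr => j _.
  rewrite /G2 ffactnS natrM exprS (_ : x + 1 + j%:R = x + j.+1%:R); last by rewrite mulrSr; ring.
  ring.
have e4 : \sum_(j < n.+1) 'C(n, j)%:R * G2 k x j (n - j).+1 =
    x * RH k + k%:R * (RH k - RH k.-1).
  rewrite /RH -sumrB !big_distrr /= -big_split /=; apply: eq_bigr => j _.
  rewrite /G2 risingS (addrAC x).
  (* [k] times the backward difference of [k ^_ j] is [j * k ^_ j]; this accounts for the [j] in the
     leading factor [x + j] of the rising factorial. *)
  have hk : k%:R * ((k ^_ j)%:R - (k.-1 ^_ j)%:R) = j%:R * (k ^_ j)%:R :> F.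
    case: k {e1 e2 e3} => [|k]; first by case: (val j) => [|m]; rewrite ?mul0r// ffact0n mulr0.
    case: (val j) => [|m]; first by rewrite !ffactn0 subrr mul0r mulr0.
    rewrite /= ffactSS ffactnSr; have [mk|km] := leqP m k.
      rewrite natrM natrM natrB// !mulrSr; ring.
    by rewrite ffact_small// !mul0n !muln0 !mulr0 subrr mulr0.
  transitivity ('C(n, j)%:R * (l + 1) ^+ j * rising (x + 1 + j%:R) (n - j) *
    (x * (k ^_ j)%:R + j%:R * (k ^_ j)%:R)); first ring.
  by rewrite -hk; ring.
rewrite e1 e2 e3 e4; ring.
Qed.
End RisingFactorial.

(** * Complex-valued functions and their integrals *)

Section ComplexParts.
Context {R : realType}.
Implicit Types (x y : R[i]) (a b : R).
Local Notation Re := complex.Re.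
Local Notation Im := complex.Im.

Lemma complex_ReD x y : Re (x + y) = Re x + Re y. Proof. by case: x; case: y. Qed.
Lemma complex_ImD x y : Im (x + y) = Im x + Im y. Proof. by case: x; case: y. Qed.
Lemma complex_ReM x y : Re (x * y) = Re x * Re y - Im x * Im y.
Proof. by case: x; case: y. Qed.
Lemma complex_ImM x y : Im (x * y) = Re x * Im y + Im x * Re y.
Proof. by case: x; case: y. Qed.
Lemma complex_Re_sum (I : Type) (r : seq I) (P : pred I) (F : I -> R[i]) :
  Re (\sum_(i <- r | P i) F i) = \sum_(i <- r | P i) Re (F i).
Proof. by apply: (big_morph (fun x => Re x) complex_ReD). Qed.
Lemma complex_Im_sum (I : Type) (r : seq I) (P : pred I) (F : I -> R[i]) :
  Im (\sum_(i <- r | P i) F i) = \sum_(i <- r | P i) Im (F i).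
Proof. by apply: (big_morph (fun x => Im x) complex_ImD). Qed.
Lemma complex_eqP x y : Re x = Re y -> Im x = Im y -> x = y.
Proof. by case: x => a b; case: y => c d /= -> ->. Qed.
Lemma complexDi a b : a +i* b = a%:C + 'i * b%:C.
Proof. by apply: complex_eqP; rewrite ?complex_ReD ?complex_ImD ?complex_ReM ?complex_ImM /=; ring. Qed.

End ComplexParts.

Section ComplexIntegral.
Context d (T : measurableType d) (R : realType) (m : {measure set T -> \bar R}).
Local Notation Re := complex.Re.
Local Notation Im := complex.Im.
Implicit Types (f g : T -> R[i]).

(** With [cint], the notions [cintegrable] and [cintegral] over an arbitrary measure, so that
    linearity serves both the plane and the [theta]-line. Over the planar measure they agree by
    conversion. *)
Definition cint_able f :=
  m.-integrable setT (EFin \o (fun x => Re (f x))) /\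
  m.-integrable setT (EFin \o (fun x => Im (f x))).

Definition cint f : R[i] := (\int[m]_x Re (f x)) +i* (\int[m]_x Im (f x)).

Lemma cint_ableZ k f : cint_able f -> cint_able (fun x => k * f x).
Proof.
move=> [f1 f2]; split.
  rewrite (_ : EFin \o _ = (fun x => ((Re k)%:E * (Re (f x))%:E - (Im k)%:E * (Im (f x))%:E)%E)).
    by apply: integrableB => //; exact: integrableZl.
  by apply/funext => x; rewrite /= complex_ReM.
rewrite (_ : EFin \o _ = (fun x => ((Re k)%:E * (Im (f x))%:E + (Im k)%:E * (Re (f x))%:E)%E)).
  by apply: integrableD => //; exact: integrableZl.
by apply/funext => x; rewrite /= complex_ImM.
Qed.

Lemma cint_ableD f g : cint_able f -> cint_able g -> cint_able (fun x => f x + g x).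
Proof.
move=> [f1 f2] [g1 g2]; split.
  rewrite (_ : EFin \o _ = (fun x => ((Re (f x))%:E + (Re (g x))%:E)%E)).
    exact: integrableD.
  by apply/funext => x; rewrite /= complex_ReD.
rewrite (_ : EFin \o _ = (fun x => ((Im (f x))%:E + (Im (g x))%:E)%E)).
  exact: integrableD.
by apply/funext => x; rewrite /= complex_ImD.
Qed.

Lemma cintZ k f : cint_able f -> cint (fun x => k * f x) = k * cint f.
Proof.
move=> [f1 f2].
have iZ (a : R) (h : T -> R) : m.-integrable setT (EFin \o h) ->
    m.-integrable setT (EFin \o (fun x => a * h x)).
  by move=> hi; exact: (@integrableZl _ _ _ m setT measurableT a _ hi).
apply: complex_eqP; rewrite ?complex_ReM ?complex_ImM /cint/=.
  under eq_Rintegral do rewrite complex_ReM.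
  rewrite RintegralB//; [|exact: iZ|exact: iZ].
  by rewrite !RintegralZl.
under eq_Rintegral do rewrite complex_ImM.
rewrite RintegralD//; [|exact: iZ|exact: iZ].
by rewrite !RintegralZl.
Qed.

Lemma cintD f g : cint_able f -> cint_able g ->
  cint (fun x => f x + g x) = cint f + cint g.
Proof.
move=> [f1 f2] [g1 g2]; apply: complex_eqP; rewrite ?complex_ReD ?complex_ImD /cint/=.
  by under eq_Rintegral do rewrite complex_ReD; rewrite RintegralD.
by under eq_Rintegral do rewrite complex_ImD; rewrite RintegralD.
Qed.

Lemma cint_able0 : cint_able (fun=> 0).
Proof. by split; exact: integrable0. Qed.

Lemma cint0 : cint (fun=> 0) = 0.
Proof. by rewrite /cint /= /Rintegral integral0. Qed.

Lemma cint_able_sum (N : nat) (F : nat -> T -> R[i]) :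
  (forall k, cint_able (F k)) -> cint_able (fun x => \sum_(k < N) F k x).
Proof.
move=> Fi; elim: N => [|N IH].
  rewrite (_ : (fun x => _) = (fun=> 0)); first exact: cint_able0.
  by apply/funext => x; rewrite big_ord0.
rewrite (_ : (fun x => _) = (fun x => \sum_(k < N) F k x + F N x)).
  exact: cint_ableD.
by apply/funext => x; rewrite big_ord_recr.
Qed.

Lemma cint_sum (N : nat) (F : nat -> T -> R[i]) :
  (forall k, cint_able (F k)) ->
  cint (fun x => \sum_(k < N) F k x) = \sum_(k < N) cint (F k).
Proof.
move=> Fi; elim: N => [|N IH].
  rewrite (_ : (fun x => _) = (fun=> 0)); first by rewrite cint0 big_ord0.
  by apply/funext => x; rewrite big_ord0.
rewrite (_ : (fun x => _) = (fun x => \sum_(k < N) F k x + F N x)).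
  by rewrite cintD//; [rewrite IH big_ord_recr|exact: cint_able_sum].
by apply/funext => x; rewrite big_ord_recr.
Qed.

Lemma cint_able_real (h : T -> R) :
  m.-integrable setT (EFin \o h) -> cint_able (fun x => (h x)%:C).
Proof. by move=> hi; split => //=; exact: integrable0. Qed.

Lemma cint_real (h : T -> R) : cint (fun x => (h x)%:C) = (\int[m]_x h x)%:C.
Proof. by rewrite /cint /= [X in _ +i* X]/Rintegral integral0. Qed.

End ComplexIntegral.

(** * Planar Gaussian moments *)

Section PlanarMoments.
Context {R : realType}.
Notation mu := (@lebesgue_measure R).
Local Notation pm := (@planar_measure R).
Variables (b c : R).
Hypothesis c0 : 0 < c.
Implicit Types p : measurableTypeR R * measurableTypeR R.

Definition planar_weight p : R := gauss_weight b c p.1 * gauss_weight 0 c p.2.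

(** The extra real powers of [p.1] and [p.2] close the family under splitting a factor [z] or
    [\bar z] into its components. *)
Let f i j k l p : R[i] :=
  (p.1 +i* p.2) ^+ i * (p.1 -i* p.2) ^+ j *
  ((p.1 ^+ k * gauss_weight b c p.1) * (p.2 ^+ l * gauss_weight 0 c p.2))%:C.

Let f_z i j k l : f i.+1 j k l = fun p => f i j k.+1 l p + 'i * f i j k l.+1 p.
Proof.
apply/funext => p; rewrite /f !exprS !rmorphM/= {1}complexDi.
ring.
Qed.

Let f_zbar i j k l : f i j.+1 k l = fun p => f i j k.+1 l p + (- 'i) * f i j k l.+1 p.
Proof.
apply/funext => p; rewrite /f !exprS !rmorphM/= (_ : p.1 -i* p.2 = p.1%:C - 'i * p.2%:C).
  ring.
by rewrite [LHS]complexDi rmorphN mulrN.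
Qed.

Let f_real k l : pm.-integrable setT (EFin \o (fun p =>
  (p.1 ^+ k * gauss_weight b c p.1) * (p.2 ^+ l * gauss_weight 0 c p.2))).
Proof.
apply: (@integrable_prodM _ _ _ _ R mu mu (fun x => x ^+ k * gauss_weight b c x)
  (fun x => x ^+ l * gauss_weight 0 c x)); exact: integrable_gauss_moment.
Qed.

Let f_able i j k l : cint_able pm (f i j k l).
Proof.
elim: i j k l => [|i IH] j k l.
  elim: j k l => [|j IH] k l.
    rewrite (_ : f _ _ _ _ = fun p => ((p.1 ^+ k * gauss_weight b c p.1) *
        (p.2 ^+ l * gauss_weight 0 c p.2))%:C); last first.
      by apply/funext => p; rewrite /f !expr0 !mul1r.
    exact/cint_able_real/f_real.
  by rewrite f_zbar; apply: cint_ableD => //; exact: cint_ableZ.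
by rewrite f_z; apply: cint_ableD => //; exact: cint_ableZ.
Qed.

Let f_int00 k l : cint pm (f 0 0 k l) = (gauss_moment b c k * gauss_moment 0 c l)%:C.
Proof.
rewrite (_ : f _ _ _ _ = fun p => ((p.1 ^+ k * gauss_weight b c p.1) *
    (p.2 ^+ l * gauss_weight 0 c p.2))%:C); last first.
  by apply/funext => p; rewrite /f !expr0 !mul1r.
rewrite cint_real; congr (_%:C).
apply: (@Rintegral_prodM _ _ _ _ R mu mu (fun x => x ^+ k * gauss_weight b c x)
  (fun x => x ^+ l * gauss_weight 0 c x)); exact: integrable_gauss_moment.
Qed.

Lemma cint_able_planar n k :
  cint_able pm (fun p => (p.1 +i* p.2) ^+ n * (p.1 -i* p.2) ^+ k * (planar_weight p)%:C).
Proof.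
have := f_able n k 0 0; rewrite /f /planar_weight.
by congr (cint_able _ _); apply/funext => p; rewrite !expr0 !mul1r.
Qed.

(* With b and c written through d and q, every moment is a power of d times a
   polynomial in q; the application has q = e^theta and d free of theta. *)
Lemma cint_planar (d q : R) n k : b = - (2 * c * d * q) -> 4 * d ^+ 2 * q * c = 1 ->
  cint pm (fun p => (p.1 +i* p.2) ^+ n * (p.1 -i* p.2) ^+ k * (planar_weight p)%:C) =
  (pi / c * expR (b ^+ 2 / (4 * c)) * d ^+ (n + k) * moment_poly q n k)%:C.
Proof.
move=> hb hc.
pose T i j k l := cint pm (f i j k l).
have iE : 'i * 'i = -1 :> R[i] by rewrite -expr2 sqr_i.
have T_z i j k' l : T i.+1 j k' l = T i j k'.+1 l + 'i * T i j k' l.+1.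
  rewrite /T f_z cintD//; last exact: cint_ableZ.
  by rewrite cintZ.
have T_zbar i j k' l : T i j.+1 k' l = T i j k'.+1 l - 'i * T i j k' l.+1.
  rewrite /T f_zbar cintD//; last exact: cint_ableZ.
  by rewrite cintZ// mulNr.
have T_x k' l : k'%:R * T 0 0 k'.-1 l = b%:C * T 0 0 k' l + 2 * c%:C * T 0 0 k'.+1 l.
  rewrite /T !f_int00 !rmorphM /= mulrA.
  have := congr1 (fun x => x%:C) (gauss_momentS b k' c0).
  rewrite rmorphM rmorphD !rmorphM /= !rmorph_nat => ->; ring.
have T_y k' l : l%:R * T 0 0 k' l.-1 = 2 * c%:C * T 0 0 k' l.+1.
  rewrite /T !f_int00 !rmorphM /= mulrCA.
  have := congr1 (fun x => x%:C) (gauss_momentS 0 l c0).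
  rewrite rmorphM rmorphD !rmorphM /= !rmorph_nat => ->; ring.
pose N i j := T i j 0 0.
have c20 : 2 * c%:C != 0 :> R[i].
  by rewrite -(rmorph_nat (real_complex R)) -rmorphM fmorph_eq0 mulf_neq0// gt_eqF.
have hbC : b%:C = - (2 * c%:C * (d%:C * q%:C)) :> R[i].
  by rewrite hb rmorphN !rmorphM rmorph_nat /= !mulrA.
have hcC : 4 * d%:C ^+ 2 * q%:C * c%:C = 1 :> R[i].
  by rewrite -(rmorph_nat (real_complex R)) -rmorphXn -!rmorphM hc.
have N0 j : N 0 j.+1 = d%:C * q%:C * N 0 j.
  apply: (mulfI c20); rewrite (moment_zbar iE T_z T_zbar T_x T_y) hbC.
  by rewrite mul0r mulr0 sub0r /N; ring.
have NS i j : N i.+1 j = d%:C * q%:C * N i j + 4 * d%:C ^+ 2 * q%:C * (j%:R * N i j.-1).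
  apply: (mulfI c20); rewrite (moment_z iE T_z T_zbar T_x T_y) hbC.
  transitivity (2 * (4 * d%:C ^+ 2 * q%:C * c%:C) * (j%:R * N i j.-1) +
     2 * c%:C * (d%:C * q%:C) * N i j); last ring.
  by rewrite hcC /N; ring.
have -> : cint pm (fun p => (p.1 +i* p.2) ^+ n * (p.1 -i* p.2) ^+ k * (planar_weight p)%:C) = N n k.
  rewrite /N /T; congr cint; apply/funext => p.
  by rewrite /f /planar_weight !expr0 !mul1r.
rewrite (moment_formula N0 NS).
have -> : N 0 0 = (pi / c * expR (b ^+ 2 / (4 * c)))%:C.
  rewrite /N /T f_int00 !gauss_moment0// expr0n /= mul0r expR0 mulr1 mulrAC.
  by rewrite -expr2 sqr_sqrtr// divr_ge0// ?pi_ge0// ltW.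
rewrite [in RHS]rmorphM [in RHS]rmorphM rmorphXn; congr (_ * _).
rewrite /moment_poly rmorph_sum /=; apply: eq_bigr => j _.
by rewrite !rmorphM !rmorphXn !rmorph_nat.
Qed.

End PlanarMoments.

(** * Polar form, principal roots and principal powers *)

Section ComplexPowers.
Context {R : realType}.
Local Notation cabs := ComplexField.Normc.normc.
Local Notation Re := complex.Re.
Local Notation Im := complex.Im.
Implicit Types (z u : R[i]) (r s t a nu : R).

Lemma conjE z : (z^*)%R = Re z -i* Im z.
Proof.
rewrite (_ : Re z -i* Im z = conjc z); last by case: z.
have [->|z0] := eqVneq z 0; first by rewrite conjC0 /= oppr0.
by apply: (mulfI z0); rewrite -normCK sqr_normc.
Qed.

Definition cis t : R[i] := cos t +i* sin t.

Lemma cis0 : cis 0 = 1.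
Proof. by rewrite /cis cos0 sin0. Qed.

Lemma cisD s t : cis (s + t) = cis s * cis t.
Proof. by apply: complex_eqP; rewrite ?complex_ReM ?complex_ImM /= ?cosD ?sinD//; ring. Qed.

Lemma cisX n t : cis (n%:R * t) = cis t ^+ n.
Proof.
elim: n => [|n IH]; first by rewrite mul0r cis0 expr0.
by rewrite exprS -IH -cisD mulrSr mulrDl mul1r addrC.
Qed.

Lemma conj_cis t : ((cis t)^*)%R = cis (- t).
Proof. by rewrite conjE /cis /= cosN sinN. Qed.

Lemma cabs_real r : 0 <= r -> cabs r%:C = r.
Proof. by move=> r0; rewrite /= expr0n addr0 sqrtr_sqr ger0_norm. Qed.

Lemma cabs_cis t : cabs (cis t) = 1.
Proof. by rewrite /= cos2Dsin2 sqrtr1. Qed.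

Lemma cabs_polar r t : 0 <= r -> cabs (r%:C * cis t) = r.
Proof. by move=> r0; rewrite ComplexField.Normc.normcM cabs_real// cabs_cis mulr1. Qed.

Lemma carg_polar r t : 0 < r -> - pi < t <= pi -> carg (r%:C * cis t) = t.
Proof.
move=> r0 /andP[t1 t2]; rewrite /carg cabs_polar; last exact: ltW.
rewrite complex_ReM complex_ImM /= !mul0r subr0 addr0.
rewrite mulrAC divff ?gt_eqF// mul1r pmulr_rge0//.
have [t0|t0] := leP 0 t.
  by rewrite sin_ge0_pi ?t0// cosK// in_itv/= t0.
have : 0 < sin (- t) by rewrite sin_gt0_pi// oppr_gt0 t0/= ltrNl.
rewrite sinN oppr_gt0 => st; rewrite leNgt st /= cosKN ?opprK//.
by rewrite !ltW.
Qed.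

Lemma normc_ge0 z : 0 <= cabs z.
Proof. by case: z => a b; exact: sqrtr_ge0. Qed.

Lemma normc_gt0 z : z != 0 -> 0 < cabs z.
Proof.
move=> z0; rewrite lt_neqAle normc_ge0 andbT eq_sym.
by apply: contra_neq z0; exact: ComplexField.Normc.eq0_normc.
Qed.

Lemma normc_sqr z : cabs z ^+ 2 = Re z ^+ 2 + Im z ^+ 2.
Proof. by case: z => a b /=; rewrite sqr_sqrtr// addr_ge0// sqr_ge0. Qed.

Lemma polarP z : z != 0 ->
  exists r t, [/\ 0 < r, - pi < t <= pi & z = r%:C * cis t].
Proof.
move=> z0; have r0 := normc_gt0 z0; set r := cabs z in r0.
have rE : r ^+ 2 = Re z ^+ 2 + Im z ^+ 2 by rewrite normc_sqr.
pose x := Re z / r; pose y := Im z / r.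
have xy : x ^+ 2 + y ^+ 2 = 1.
  by rewrite /x /y !expr_div_n -mulrDl -rE divff// expf_neq0// gt_eqF.
have x1 : -1 <= x <= 1.
  rewrite -ler_norml -(ler_pXn2r (n := 2)) ?nnegrE// expr1n real_normK ?num_real//.
  by rewrite -xy lerDl sqr_ge0.
have pi0 : 0 < pi :> R := pi_gt0 R.
exists r, (if 0 <= y then acos x else - acos x); split => //.
  case: ifPn => y0.
    by rewrite acos_lepi// andbT (@lt_le_trans _ _ 0) ?acos_ge0// oppr_lt0.
  (* Here [y] is nonzero, so [x] is not -1 and [acos x < pi]: the argument - pi is excluded. *)
  have y0' : 0 < y ^+ 2 by rewrite exprn_even_gt0//= lt_eqF// ltNge.
  have xN1 : -1 < x.
    rewrite lt_neqAle (andP x1).1 andbT; apply/eqP => xE.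
    by move: xy; rewrite -xE sqrrN expr1n => /eqP; rewrite addrC -subr_eq0 addrK gt_eqF.
  rewrite ltrN2 acos_ltpi ?xN1 ?(andP x1).2//=.
  by rewrite (@le_trans _ _ 0) ?oppr_le0 ?acos_ge0// ltW.
have yE : `|y| = Num.sqrt (1 - x ^+ 2) by rewrite -xy addrAC subrr add0r sqrtr_sqr.
apply: complex_eqP; rewrite ?complex_ReM ?complex_ImM /= mul0r ?subr0 ?addr0.
  rewrite (_ : cos _ = x); first by rewrite mulrC divfK// gt_eqF.
  by case: ifP => _; rewrite ?cosN acosK// in_itv.
rewrite (_ : sin _ = y); first by rewrite mulrC divfK// gt_eqF.
case: ifPn => y0; rewrite ?sinN sin_acos// -yE; first by rewrite ger0_norm.
by rewrite ltr0_norm ?opprK// ltNge.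
Qed.

Lemma cpow_polar r t s : 0 < r -> - pi < t <= pi ->
  cpow (r%:C * cis t) s = (r `^ s)%:C * cis (s * t).
Proof.
move=> r0 ht; rewrite /cpow cabs_polar ?ltW// carg_polar//.
by apply: complex_eqP; rewrite ?complex_ReM ?complex_ImM /=; ring.
Qed.

Lemma cpow0 s : s != 0 -> cpow (0 : R[i]) s = 0.
Proof.
move=> s0; rewrite /cpow ComplexField.Normc.normc0 powR0//.
by apply: complex_eqP; rewrite /= mul0r.
Qed.

Lemma cpowr0 z : cpow z 0 = 1.
Proof. by rewrite /cpow powRr0 !mul0r cos0 sin0 mulr1 mulr0. Qed.

(** Half-angle formulas. On the principal range [cos (t / 2) >= 0], in accordance with the
    nonnegative real part of [sqrtc]; what is left is the sign of the imaginary part. *)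
Lemma sqrtc_polar r t : 0 < r -> - pi < t <= pi ->
  sqrtc (r%:C * cis t) = (Num.sqrt r)%:C * cis (t / 2).
Proof.
move=> r0 /andP[t1 t2].
have pi0 : 0 < pi :> R := pi_gt0 R.
have c0 : 0 <= cos (t / 2) by apply: cos_ge0_pihalf; apply/andP; split; lra.
have ct : cos t = 2 * cos (t / 2) ^+ 2 - 1.
  by rewrite {1}(_ : t = (t / 2) *+ 2) ?cos_mulr2n ?mulr_natl// -mulr_natr divfK.
have st : sin t = 2 * (cos (t / 2) * sin (t / 2)).
  by rewrite {1}(_ : t = (t / 2) *+ 2) ?sin_mulr2n ?mulr_natl// -mulr_natr divfK.
have r0' := ltW r0.
have sq := cos2Dsin2 (t / 2).
have e1 : (r + r * cos t) / 2 = r * cos (t / 2) ^+ 2 by rewrite ct; field.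
have e2 : (r - r * cos t) / 2 = r * sin (t / 2) ^+ 2.
  by rewrite ct -[X in r - _ * (_ - X)]sq; rewrite -{1}[r]mulr1 -{1}sq; field.
have nr : Num.sqrt ((r * cos t) ^+ 2 + (r * sin t) ^+ 2) = r.
  by rewrite !exprMn -mulrDr cos2Dsin2 mulr1 sqrtr_sqr ger0_norm.
have -> : r%:C * cis t = (r * cos t) +i* (r * sin t).
  by apply: complex_eqP; rewrite ?complex_ReM ?complex_ImM /=; ring.
rewrite /sqrtc /= nr e1 e2 !(sqrtrM _ r0') !sqrtr_sqr (ger0_norm c0).
apply: complex_eqP; rewrite ?complex_ReM ?complex_ImM /= mul0r ?subr0 ?addr0//.
rewrite mulrCA; congr (_ * _).
rewrite mulf_eq0 gt_eqF//=.
(* [sqrtc] takes the sign +1 when [sin t = 0]. The range of [t] then forces [t >= 0], hence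
   [sin (t / 2) >= 0]. *)
have [s0|s0] := eqVneq (sin t) 0.
  rewrite mul1r; apply: ger0_norm.
  have [t0|t0] := leP 0 t; first by apply: sin_ge0_pi; apply/andP; split; lra.
  have : 0 < sin (- t) by apply: sin_gt0_pi; apply/andP; split; lra.
  by rewrite sinN s0 oppr0 ltxx.
have sgE : Num.sg (r * sin t) = Num.sg (sin (t / 2)).
  rewrite sgrM gtr0_sg// mul1r st sgrM gtr0_sg// mul1r sgrM gtr0_sg ?mul1r//.
  rewrite lt_neqAle c0 andbT eq_sym; apply: contra_neq s0 => h.
  by rewrite st h mul0r mulr0.
by rewrite sgE -numEsg.
Qed.

(** The arguments of the two roots add up inside the principal range, and
    [(sqrt z)^nu = z^(nu / 2)]. This lets [z^(nu / 2)] leave the integral pointwise. *)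
Lemma cpow_besselI_arg a nu z u : 0 < a ->
  cpow (a%:C * (sqrtc z * ((sqrtc u)^*)%R)) nu =
  cpow z (nu / 2) * cpow (a%:C * ((sqrtc u)^*)%R) nu.
Proof.
move=> a0.
(* Powers of 0 depend on the exponent: at [nu = 0] all of them are 1, otherwise [z = 0] or [u = 0]
   makes both sides 0. *)
have [->|nu0] := eqVneq nu 0; first by rewrite mul0r !cpowr0 mulr1.
have nu20 : nu / 2 != 0 by rewrite mulf_neq0// invr_neq0.
have [->|z0] := eqVneq z 0.
  by rewrite sqrtc0 mul0r mulr0 !cpow0// mul0r.
have [->|u0] := eqVneq u 0.
  by rewrite sqrtc0 conjC0 !mulr0 !cpow0// mulr0.
have [r [t [r0 ht ->]]] := polarP z0.
have [r' [t' [r'0 ht' ->]]] := polarP u0.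
have pi0 : 0 < pi :> R := pi_gt0 R.
move: (ht) (ht') => /andP[t1 t2] /andP[t1' t2'].
rewrite !sqrtc_polar// rmorphM /= conj_cis (_ : (((Num.sqrt r')%:C)^*)%R = (Num.sqrt r')%:C); last first.
  by rewrite conjE /= oppr0.
have -> : a%:C * ((Num.sqrt r)%:C * cis (t / 2) * ((Num.sqrt r')%:C * cis (- (t' / 2)))) =
    (a * Num.sqrt r * Num.sqrt r')%:C * cis (t / 2 + - (t' / 2)).
  by rewrite cisD !rmorphM /=; ring.
rewrite (mulrA a%:C) -(rmorphM _ a (Num.sqrt r')).
rewrite !cpow_polar ?mulr_gt0 ?sqrtr_gt0//; try (by apply/andP; split; lra).
have -> : nu * (t / 2 + - (t' / 2)) = nu / 2 * t + nu * - (t' / 2) by ring.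
have e : (a * Num.sqrt r * Num.sqrt r') `^ nu =
    r `^ (nu / 2) * (a * Num.sqrt r') `^ nu.
  rewrite !powRM ?sqrtr_ge0 ?mulr_ge0 ?sqrtr_ge0 ?ltW//.
  rewrite -!powR12_sqrt ?ltW// -!powRrM (mulrC 2^-1); ring.
rewrite e cisD rmorphM /=; ring.
Qed.

(** With [t] the argument of [u], the phase [nu t / 2] of [u^(nu / 2)] cancels against [- nu t / 2]
    from the conjugate root. What remains has no branches. *)
Lemma cpow_u_besselI_arg a nu n u : 0 < a -> u != 0 ->
  cpow u (n%:R + nu / 2) * cpow (a%:C * ((sqrtc u)^*)%R) nu =
  (a `^ nu * cabs u `^ nu)%:C * u ^+ n.
Proof.
move=> a0 u0.
have [r [t [r0 ht ->]]] := polarP u0.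
have pi0 : 0 < pi :> R := pi_gt0 R.
move: (ht) => /andP[t1 t2].
rewrite cabs_polar; last exact: ltW.
rewrite !sqrtc_polar// rmorphM /= conj_cis (_ : (((Num.sqrt r)%:C)^*)%R = (Num.sqrt r)%:C); last first.
  by rewrite conjE /= oppr0.
rewrite (mulrA a%:C) -rmorphM.
rewrite !cpow_polar ?mulr_gt0 ?sqrtr_gt0//; try (by apply/andP; split; lra).
rewrite exprMn -cisX.
have -> : n%:R * t = (n%:R + nu / 2) * t + nu * - (t / 2) by ring.
rewrite cisD -rmorphXn /= -powR_mulrn ?ltW//.
have e : r `^ (n%:R + nu / 2) * (a * Num.sqrt r) `^ nu = a `^ nu * r `^ nu * r `^ n%:R.
  have r0' : r != 0 by rewrite gt_eqF.
  rewrite powRM ?sqrtr_ge0 ?ltW// -powR12_sqrt ?ltW// -powRrM.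
  rewrite mulrCA -mulrA -!powRD ?r0' ?implybT//; congr (_ * _ `^ _).
  by field.
rewrite mulrACA -rmorphM e rmorphM; ring.
Qed.

End ComplexPowers.

(** * Convergence of complex sequences *)

Section ComplexConvergence.
Context {R : realType}.
Local Notation cabs := ComplexField.Normc.normc.
Local Notation Re := complex.Re.
Local Notation Im := complex.Im.
Implicit Types (u v : nat -> R[i]) (l z w s : R[i]).

Definition ccvg u l :=
  (Re (u n) @[n --> \oo] --> Re l) /\ (Im (u n) @[n --> \oo] --> Im l).

Lemma ccvg_unique u l l' : ccvg u l -> ccvg u l' -> l = l'.
Proof.
move=> [u1 u2] [v1 v2]; apply: complex_eqP.
  by apply: (cvg_unique _ u1 v1); exact: Rhausdorff.
by apply: (cvg_unique _ u2 v2); exact: Rhausdorff.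
Qed.

Lemma ccvg_cst l : ccvg (fun=> l) l.
Proof. by split; exact: cvg_cst. Qed.

Lemma ccvgD u v l l' : ccvg u l -> ccvg v l' -> ccvg (fun n => u n + v n) (l + l').
Proof.
move=> [u1 u2] [v1 v2]; split.
  rewrite complex_ReD; under eq_fun do rewrite complex_ReD; exact: cvgD.
rewrite complex_ImD; under eq_fun do rewrite complex_ImD; exact: cvgD.
Qed.

Lemma ccvgM u v l l' : ccvg u l -> ccvg v l' -> ccvg (fun n => u n * v n) (l * l').
Proof.
move=> [u1 u2] [v1 v2]; split.
  rewrite complex_ReM; under eq_fun do rewrite complex_ReM.
  by apply: cvgB; exact: cvgM.
rewrite complex_ImM; under eq_fun do rewrite complex_ImM.
by apply: cvgD; exact: cvgM.
Qed.

Lemma ccvgZ k u l : ccvg u l -> ccvg (fun n => k * u n) (k * l).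
Proof. by apply: ccvgM; exact: ccvg_cst. Qed.

Lemma ccvg_sum (I : Type) (r : seq I) (u : I -> nat -> R[i]) (l : I -> R[i]) :
  (forall i, ccvg (u i) (l i)) ->
  ccvg (fun n => \sum_(i <- r) u i n) (\sum_(i <- r) l i).
Proof.
move=> ul; elim: r => [|i r IH].
  rewrite big_nil; under eq_fun do rewrite big_nil; exact: ccvg_cst.
rewrite big_cons; under eq_fun do rewrite big_cons; exact: ccvgD.
Qed.

Lemma ccvg_shift m u l : ccvg u l -> ccvg (fun n => u (n - m)%N) l.
Proof.
move=> [u1 u2]; split.
  by apply: (cvg_comp _ _ _ u1); exact: (@cvg_subnr m).
by apply: (cvg_comp _ _ _ u2); exact: (@cvg_subnr m).
Qed.

Lemma normc_Re z : `|Re z| <= cabs z.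
Proof.
case: z => a b /=; rewrite -sqrtr_sqr ler_wsqrtr// lerDl sqr_ge0//.
Qed.

Lemma normc_Im z : `|Im z| <= cabs z.
Proof.
case: z => a b /=; rewrite -sqrtr_sqr ler_wsqrtr// lerDr sqr_ge0//.
Qed.

Lemma normcX z n : cabs (z ^+ n) = cabs z ^+ n.
Proof.
elim: n => [|n IH]; first by rewrite !expr0 ComplexField.Normc.normc1.
by rewrite !exprS ComplexField.Normc.normcM IH.
Qed.

Lemma normc_sum (N : nat) (F : nat -> R[i]) :
  cabs (\sum_(k < N) F k) <= \sum_(k < N) cabs (F k).
Proof.
elim: N => [|N IH]; first by rewrite !big_ord0 ComplexField.Normc.normc0.
rewrite !big_ord_recr /= (le_trans (le_normcD _ _))// lerD2r//.
Qed.

Lemma ccvg_cseries (c : nat -> R[i]) (B : R^nat) :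
  (forall k, cabs (c k) <= B k) -> cvgn (series B) ->
  ccvg (fun N => \sum_(k < N) c k) (cseries c).
Proof.
move=> cB cvB.
have H (f : nat -> R) : (forall k, `|f k| <= B k) -> cvgn (series f).
  move=> fB; apply: normed_cvg; apply: series_le_cvg cvB => //= k.
  by apply: le_trans (fB k).
split; rewrite /cseries /=.
  under eq_fun do rewrite complex_Re_sum -(big_mkord xpredT (fun k => Re (c k))).
  by apply: H => k; apply: le_trans (cB k); exact: normc_Re.
under eq_fun do rewrite complex_Im_sum -(big_mkord xpredT (fun k => Im (c k))).
by apply: H => k; apply: le_trans (cB k); exact: normc_Im.
Qed.

End ComplexConvergence.

(** * The power series of the complex exponential *)

Section ComplexExponential.
Context {R : realType}.
Local Notation cabs := ComplexField.Normc.normc.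
Local Notation Re := complex.Re.
Local Notation Im := complex.Im.
Implicit Types (z w s : R[i]) (t : R).

Lemma cexp0 : cexp (0 : R[i]) = 1.
Proof. by rewrite /cexp /= expR0 cos0 sin0 mulr1 mulr0. Qed.

Lemma cexpD z w : cexp (z + w) = cexp z * cexp w.
Proof.
apply: complex_eqP; rewrite ?complex_ReM ?complex_ImM /= complex_ReD complex_ImD ?cosD ?sinD expRD; ring.
Qed.

Lemma cabs_cexp z : cabs (cexp z) = expR (Re z).
Proof. by rewrite /= !exprMn -mulrDr cos2Dsin2 mulr1 sqrtr_sqr ger0_norm ?expR_ge0. Qed.

Let g s t := cexp (- (t%:C * s)).

Let g_Re s t : Re (g s t) = expR (- Re s * t) * cos (- Im s * t).
Proof. by case: s => a b; rewrite /g /= !mul0r subr0 addr0 !mulNr (mulrC t a) (mulrC t b). Qed.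

Let g_Im s t : Im (g s t) = expR (- Re s * t) * sin (- Im s * t).
Proof. by case: s => a b; rewrite /g /= !mul0r subr0 addr0 !mulNr (mulrC t a) (mulrC t b). Qed.

Let is_derive_lin (k t : R) : is_derive t (1 : R) (fun t => k * t) k.
Proof. by apply: is_derive_eq; rewrite /GRing.scale/= mulr1. Qed.

Let is_derive_cos (k t : R) : is_derive t (1 : R) (fun t => cos (k * t)) (- k * sin (k * t)).
Proof.
have := @is_derive1_comp _ cos (fun t => k * t) t (- sin (k * t)) k (is_derive_cos _) (is_derive_lin k t).
by rewrite mulrC mulrN -mulNr.
Qed.

Let is_derive_sin (k t : R) : is_derive t (1 : R) (fun t => sin (k * t)) (k * cos (k * t)).
Proof.
have := @is_derive1_comp _ sin (fun t => k * t) t (cos (k * t)) k (is_derive_sin _) (is_derive_lin k t).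
by rewrite mulrC.
Qed.

Let is_derive_pow (n : nat) t : is_derive t (1 : R) (fun t => t ^+ n) (n%:R * t ^+ n.-1).
Proof.
have := @is_deriveX R R id n t 1 1 (is_derive_id _ _).
by rewrite /GRing.scale/= mulr1 exprfctE.
Qed.

Let gR_derive s t : is_derive t (1 : R) (fun t => Re (g s t)) (Re (- s * g s t)).
Proof.
rewrite (_ : (fun t => _) = (fun t => expR (- Re s * t) * cos (- Im s * t))); last first.
  by apply/funext => x; rewrite g_Re.
have h1 := is_derive_cos (- Im s) t.
have h2 := is_derive_expR_comp (is_derive_lin (- Re s) t).
apply: is_derive_eq.
by rewrite complex_ReM g_Re g_Im /GRing.scale/=; case: s {h1 h2} => a b /=; ring.
Qed.

Let gI_derive s t : is_derive t (1 : R) (fun t => Im (g s t)) (Im (- s * g s t)).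
Proof.
rewrite (_ : (fun t => _) = (fun t => expR (- Re s * t) * sin (- Im s * t))); last first.
  by apply/funext => x; rewrite g_Im.
have h1 := is_derive_sin (- Im s) t.
have h2 := is_derive_expR_comp (is_derive_lin (- Re s) t).
apply: is_derive_eq.
by rewrite complex_ImM g_Re g_Im /GRing.scale/=; case: s {h1 h2} => a b /=; ring.
Qed.

Let T s N t := \sum_(k < N) (t ^+ k)%:C * (s ^+ k / k`!%:R).

Let coefE s k : k.+1%:R * (s ^+ k.+1 / k.+1`!%:R) = s * (s ^+ k / k`!%:R).
Proof.
have k1 : k.+1%:R != 0 :> R[i] by rewrite pnatr_eq0.
rewrite factS natrM exprS invfM -!mulrA mulrCA; congr (_ * _).
by rewrite mulrCA mulVKf.
Qed.

(* The derivative telescopes to its last term; the mean value theorem on [0, 1]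
   compares e^(- s) * (partial sum of e^s) with 1. *)
Let D_derive s N t :
  is_derive t (1 : R) (fun t => Re (g s t * T s N.+1 t))
    (Re (- s * g s t * ((t ^+ N)%:C * (s ^+ N / N`!%:R)))) /\
  is_derive t (1 : R) (fun t => Im (g s t * T s N.+1 t))
    (Im (- s * g s t * ((t ^+ N)%:C * (s ^+ N / N`!%:R)))).
Proof.
elim: N => [|N [IHr IHi]].
  rewrite (_ : T s 1 = fun=> 1); last first.
    by apply/funext => x; rewrite /T big_ord1 !expr0 fact0 divr1 mulr1.
  under eq_fun do rewrite mulr1; under [X in _ /\ is_derive _ _ X _]eq_fun do rewrite mulr1.
  by rewrite !expr0 fact0 divr1 !mulr1; split; [exact: gR_derive|exact: gI_derive].
set c := s ^+ N.+1 / N.+1`!%:R.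
have TS : T s N.+2 = fun x => T s N.+1 x + (x ^+ N.+1)%:C * c.
  by apply/funext => x; rewrite /T big_ord_recr.
have h1 := gR_derive s t; have h2 := gI_derive s t; have h3 := is_derive_pow N.+1 t.
have cE : s * (s ^+ N / N`!%:R) = N.+1%:R * c by rewrite coefE.
have e : - s * g s t * ((t ^+ N)%:C * (s ^+ N / N`!%:R)) +
   (- s * g s t * (t ^+ N.+1)%:C + g s t * (N.+1%:R * t ^+ N)%:C) * c =
   - s * g s t * ((t ^+ N.+1)%:C * c).
  rewrite rmorphM /= rmorph_nat.
  transitivity (- (g s t * (t ^+ N)%:C * (s * (s ^+ N / N`!%:R))) +
   (- s * g s t * (t ^+ N.+1)%:C + g s t * (N.+1%:R * (t ^+ N)%:C)) * c); first ring.
  by rewrite cE; ring.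
split.
  rewrite (_ : (fun t => _) = (fun t => Re (g s t * T s N.+1 t) +
      (Re (g s t) * t ^+ N.+1 * Re c - Im (g s t) * t ^+ N.+1 * Im c))); last first.
    apply/funext => x; rewrite TS mulrDr complex_ReD mulrA; congr (_ + _).
    by rewrite complex_ReM complex_ReM complex_ImM /=; ring.
  apply: is_derive_eq.
  rewrite -e complex_ReD; congr (_ + _).
  move: (- s * g s t) (g s t) (c) => w gt c'; rewrite /GRing.scale/=.
  by rewrite !(complex_ReM, complex_ReD, complex_ImD, complex_ImM) /=; ring.
rewrite (_ : (fun t => _) = (fun t => Im (g s t * T s N.+1 t) +
      (Re (g s t) * t ^+ N.+1 * Im c + Im (g s t) * t ^+ N.+1 * Re c))); last first.
  apply/funext => x; rewrite TS mulrDr complex_ImD mulrA; congr (_ + _).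
  by rewrite complex_ImM complex_ReM complex_ImM /=; ring.
apply: is_derive_eq.
rewrite -e complex_ImD; congr (_ + _).
move: (- s * g s t) (g s t) (c) => w gt c'; rewrite /GRing.scale/=.
by rewrite !(complex_ReM, complex_ReD, complex_ImD, complex_ImM) /=; ring.
Qed.

(** [cexp] is defined through real functions, so its series needs a proof. On [[0, 1]] the
    derivative of [e^(- t s)] times the partial sum is at most [|s| e^|s| |s|^N / N!], which tends
    to 0. Hence the value at [t = 1] tends to the value 1 at [t = 0]; multiplication by [e^s]
    concludes. *)
Lemma ccvg_cexp s : ccvg (fun N => \sum_(k < N) s ^+ k / k`!%:R) (cexp s).
Proof.
pose a := cabs s; pose B N := a * expR a * exp_coeff a N.
have B0 : B N @[N --> \oo] --> (0 : R).
  rewrite -(mulr0 (a * expR a)); apply: cvgMr.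
  apply: cvg_series_cvg_0; exact: is_cvg_series_exp_coeff.
have bound N t : 0 <= t <= 1 -> cabs (- s * g s t * ((t ^+ N)%:C * (s ^+ N / N`!%:R))) <= B N.
  move=> /andP[t0 t1].
  have a0 : 0 <= a by exact: normc_ge0.
  rewrite !ComplexField.Normc.normcM normcN -/a cabs_cexp normcX -/a.
  rewrite ComplexField.Normc.normcV cabs_real ?exprn_ge0//.
  rewrite (_ : cabs N`!%:R = N`!%:R); last by rewrite -(rmorph_nat (real_complex R)) cabs_real.
  rewrite /B /exp_coeff -mulrA -mulrA; apply: ler_wpM2l => //.
  apply: ler_pM; rewrite ?expR_ge0 ?mulr_ge0 ?exprn_ge0 ?invr_ge0//.
    rewrite ler_expR; apply: le_trans (ler_norm _) _; apply: le_trans (normc_Re _) _.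
    by rewrite normcN ComplexField.Normc.normcM cabs_real// ler_piMl.
  by rewrite ler_piMl ?mulr_ge0 ?exprn_ge0 ?invr_ge0// exprn_ile1.
have g0 : g s 0 = 1 by rewrite /g mul0r oppr0 cexp0.
have T0 N : T s N.+1 0 = 1.
  rewrite /T big_ord_recl /= big1 ?addr0; last first.
    by move=> i _; rewrite /bump /= add1n expr0n mul0r.
  by rewrite !expr0 fact0 divr1 mulr1.
have mvt (F F' : R -> R) b : (forall t, is_derive t (1 : R) F (F' t)) ->
    (forall t, 0 <= t <= 1 -> `|F' t| <= b) -> `|F 1 - F 0| <= b.
  move=> dF Fb.
  have [c] : exists2 c, c \in `]0, 1[ & F 1 - F 0 = F' c * (1 - 0).
    apply: MVT => //.
    by apply: continuous_subspaceT; exact: continuous_is_derive dF.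
  rewrite in_itv/= => /andP[c0 c1] ->; rewrite subr0 mulr1; apply: Fb.
  by rewrite !ltW.
have D1 : ccvg (fun N => g s 1 * T s N.+1 1) 1.
  split.
    apply: (@cvg_zero _ R^o).
    apply: (@squeeze_cvgr _ _ _ _ (fun N => - B N) B) => //; last by rewrite -oppr0; exact: cvgN.
    apply: nearW => N; rewrite -ler_norml.
    rewrite -(_ : Re (g s 0 * T s N.+1 0) = Re 1); last by rewrite g0 T0 mulr1.
    apply: (mvt (fun t => Re (g s t * T s N.+1 t))).
      by move=> t; exact: (D_derive s N t).1.
    by move=> t t01; apply: le_trans (normc_Re _) _; exact: bound.
  apply: (@cvg_zero _ R^o).
  apply: (@squeeze_cvgr _ _ _ _ (fun N => - B N) B) => //; last by rewrite -oppr0; exact: cvgN.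
  apply: nearW => N; rewrite -ler_norml.
  rewrite -(_ : Im (g s 0 * T s N.+1 0) = Im 1); last by rewrite g0 T0 mulr1.
  apply: (mvt (fun t => Im (g s t * T s N.+1 t))).
    by move=> t; exact: (D_derive s N t).2.
  by move=> t t01; apply: le_trans (normc_Im _) _; exact: bound.
have := ccvgZ (cexp s) D1; rewrite mulr1 => H.
have HE : (fun N => cexp s * (g s 1 * T s N.+1 1)) = (fun N => \sum_(k < N.+1) s ^+ k / k`!%:R).
  apply/funext => N; rewrite mulrA /g mul1r -cexpD subrr cexp0 mul1r /T.
  by apply: eq_bigr => k _; rewrite expr1n mul1r.
rewrite HE in H.
by case: H => H1 H2; split; rewrite -cvg_shiftS.
Qed.

(** Since [k ^_ m / k! = 1 / (k - m)!] for [m <= k], this is the exponential series shifted by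
    [m]. *)
Lemma ccvg_cexp_ffact s m :
  ccvg (fun N => \sum_(k < N) (k ^_ m)%:R * (s ^+ k / k`!%:R)) (s ^+ m * cexp s).
Proof.
have H := ccvgZ (s ^+ m) (ccvg_shift m (ccvg_cexp s)).
have E : (fun N => s ^+ m * \sum_(k < N - m) s ^+ k / k`!%:R) =
  (fun N => \sum_(k < N) (k ^_ m)%:R * (s ^+ k / k`!%:R)).
  (* For [N <= m] truncated subtraction makes the shifted sum empty, and every [k ^_ m] on the other
     side is 0. *)
  apply/funext => N; have [Nm|mN] := leqP N m.
    rewrite (eqP (_ : (N - m == 0)%N)) ?subn_eq0// big_ord0 mulr0 big1// => k _.
    by rewrite ffact_small ?mul0r// (leq_trans (ltn_ord k)).
  rewrite -[in RHS](subnKC (ltnW mN)) big_split_ord /= [X in _ = X + _]big1 ?add0r; last first.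
    by move=> k _; rewrite ffact_small ?mul0r.
  rewrite big_distrr /=; apply: eq_bigr => k _; rewrite exprD.
  have := ffact_fact (leq_addr k m); rewrite addKn => fE.
  rewrite -fE natrM.
  have k0 : (k`!)%:R != 0 :> R[i] by rewrite pnatr_eq0 -lt0n fact_gt0.
  have k1 : ((m + k) ^_ m)%:R != 0 :> R[i] by rewrite pnatr_eq0 -lt0n ffact_gt0 leq_addr.
  by field; rewrite k0 k1.
by rewrite -E.
Qed.

End ComplexExponential.

(** * The power series of I_nu *)

Section BesselSeries.
Context {R : realType}.
Local Notation cabs := ComplexField.Normc.normc.
Local Notation Re := complex.Re.
Local Notation Im := complex.Im.
Implicit Types (nu x : R) (z w : R[i]).

Lemma Gamma_rising x m : 0 < x -> Gamma (x + m%:R) = rising x m * Gamma x.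
Proof.
elim: m x => [|m IH] x x0; first by rewrite addr0 rising0 mul1r.
rewrite (_ : x + m.+1%:R = x + 1 + m%:R); last by rewrite mulrSr addrAC addrA.
rewrite (IH _ (addr_gt0 x0 ltr01)) risingS (GammaS x0).
by move: (rising _ _) (Gamma x) => a b; ring.
Qed.

(** The coefficients of [besselI_even] in powers of [(w / 2)^2]. *)
Definition besselI_coef nu k : R := (k`!%:R * Gamma (k%:R + nu + 1))^-1.

Lemma besselI_arg_gt0 nu k : -1 < nu -> 0 < k%:R + nu + 1 :> R.
Proof. by move=> nu1; have : 0 <= k%:R :> R by []; lra. Qed.

Lemma besselI_coef_gt0 nu k : -1 < nu -> 0 < besselI_coef nu k.
Proof.
move=> nu1; rewrite invr_gt0 mulr_gt0 ?ltr0n ?fact_gt0// Gamma_gt0//.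
exact: besselI_arg_gt0.
Qed.

(** The sequence [D^k / Gamma (k + nu + 1)] has consecutive ratios [D / (k + nu + 1)], which are at
    most 1 from the index [K] on, so it is bounded by the sum of its first terms. *)
Lemma besselI_coef_le nu (D : R) : -1 < nu -> 0 < D ->
  exists M : R, 0 < M /\ forall k, D ^+ k * besselI_coef nu k <= M * (k`!%:R)^-1.
Proof.
move=> nu1 D0; pose y k : R := D ^+ k / Gamma (k%:R + nu + 1).
have y0 k : 0 < y k by rewrite divr_gt0 ?exprn_gt0// Gamma_gt0// besselI_arg_gt0.
have yS k : y k.+1 = D / (k%:R + nu + 1) * y k.
  rewrite /y (_ : k.+1%:R + nu + 1 = k%:R + nu + 1 + 1); last by rewrite mulrSr; ring.
  have k0 := besselI_arg_gt0 k nu1.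
  rewrite GammaS// exprS; field.
  by rewrite !gt_eqF// Gamma_gt0.
pose K := (Num.bound D).+1.
have KD k : (K <= k)%N -> y k.+1 <= y k.
  move=> Kk; rewrite yS ler_piMl ?(ltW (y0 k))// ler_pdivrMr ?besselI_arg_gt0// mul1r.
  have DB : D < (Num.bound D)%:R by apply: archi_boundP; exact: ltW.
  have : K%:R <= k%:R :> R by rewrite ler_nat.
  rewrite /K mulrSr; lra.
pose M := \sum_(k < K.+1) y k.
have yM k : y k <= M.
  have [kK|] := leqP k K.
    rewrite /M (bigD1 (Ordinal (kK : (k < K.+1)%N)))//= lerDl sumr_ge0// => i _.
    exact: ltW.
  elim: k => // k IH; rewrite ltnS leq_eqVlt => /predU1P[<-|Kk].
    apply: le_trans (KD _ (leqnn _)) _.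
    rewrite /M (bigD1 ord_max)//= lerDl sumr_ge0// => i _.
    exact: ltW.
  by apply: le_trans (KD _ (ltnW Kk)) (IH Kk).
exists M; split; first exact: lt_le_trans (y0 0%N) (yM 0%N).
move=> k; rewrite /besselI_coef invfM mulrCA mulrC ler_wpM2r ?invr_ge0//.
exact: yM.
Qed.

Lemma sum_exp_coeff_le x N : 0 <= x -> \sum_(k < N) x ^+ k / k`!%:R <= expR x.
Proof.
move=> x0; rewrite -(big_mkord xpredT (fun k => x ^+ k / k`!%:R)).
rewrite /expR; apply: (nondecreasing_cvgn_le _ (is_cvg_series_exp_coeff x)).
apply: nondecreasing_series => k _ _.
by rewrite /exp_coeff /= divr_ge0// exprn_ge0.
Qed.

(** [D] is arbitrary, so the rate [1 / D] can be made as small as desired; this gives the room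
    needed to dominate the partial sums. *)
Lemma besselI_sum_le nu (D : R) : -1 < nu -> 0 < D ->
  exists M : R, 0 < M /\ forall x N, 0 <= x ->
    \sum_(k < N) x ^+ k * besselI_coef nu k <= M * expR (x / D).
Proof.
move=> nu1 D0; have [M [M0 HM]] := besselI_coef_le nu1 D0.
exists M; split => // x N x0.
have xD : 0 <= x / D by rewrite divr_ge0// ltW.
apply: (@le_trans _ _ (M * \sum_(k < N) (x / D) ^+ k / k`!%:R)); last first.
  by rewrite ler_wpM2l ?sum_exp_coeff_le// ltW.
rewrite big_distrr /=; apply: ler_sum => k _.
rewrite mulrCA -{1}(divfK (_ : D != 0) x) ?gt_eqF// exprMn -mulrA ler_wpM2l ?exprn_ge0//.
Qed.

Lemma ccvg_besselI_even nu w (x : R[i]) : -1 < nu -> (w / 2) ^+ 2 = x ->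
  ccvg (fun N => \sum_(k < N) x ^+ k * (besselI_coef nu k)%:C) (besselI_even nu w).
Proof.
move=> nu1 wx; rewrite /besselI_even.
have -> : (fun k => (w / 2) ^+ (2 * k) / (k`!%:R * Gamma (k%:R + nu + 1))%:C) =
    (fun k => x ^+ k * (besselI_coef nu k)%:C).
  by apply/funext => k; rewrite exprM wx fmorphV.
have [M [M0 HM]] := besselI_coef_le nu1 ltr01.
apply: (@ccvg_cseries _ _ (fun k => M * exp_coeff (cabs x) k)).
  move=> k; rewrite ComplexField.Normc.normcM normcX cabs_real; last first.
    by rewrite ltW// besselI_coef_gt0.
  have := HM k; rewrite expr1n mul1r => H.
  by rewrite /exp_coeff /= mulrCA ler_wpM2l// exprn_ge0// normc_ge0.
apply: is_cvg_seriesZ; exact: is_cvg_series_exp_coeff.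
Qed.

End BesselSeries.

(** * Resummation into the Laguerre polynomial *)

Section LaguerreSeries.
Context {R : realType}.
Variables (alpha nu : R) (n : nat).
Hypotheses (alpha0 : 0 < alpha) (nu1 : -1 < nu).

(** The planar integral of [u^n \bar u^k e^(- alpha Re u / 6)] against the Gaussian mixture, as
    [cint_monomial] shows. The mass [pi / c] supplies [36 / alpha^2] and one [e^theta], hence
    [nu + 1]; [- 3 / alpha] is the [d] of the planar moments; [3 / 4] is 1 less the [1 / 4] of the
    completed square. *)
Definition theta_moment k : R :=
  pi * 36 / alpha ^+ 2 * (- 3 / alpha) ^+ (n + k) *
  \sum_(j < n.+1) 'C(n, j)%:R * ((k ^_ j)%:R * 4 ^+ j *
    ((3 / 4) `^ (- (nu + 1 + (n - j + k)%:R)) * Gamma (nu + 1 + (n - j + k)%:R))).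

(** The coefficient of [z^k] in the integral after cancelling [z^(nu / 2)]. The constant
    [2^-1 * (3 / 2)^nu] collects [(alpha / 4)^nu] from I_nu and [(alpha / 3)^(- nu) * 2^nu / 2] from
    K_nu. *)
Definition series_coef k : R :=
  2^-1 * (3 / 2) `^ nu * ((alpha / 4) ^+ 2) ^+ k * besselI_coef nu k * theta_moment k.

(** The constant of the theorem without [n!], which the binomial coefficients absorb. *)
Let K : R := (-1) ^+ n * 3 * pi * 2 `^ (nu + 3) * 4 ^+ n / alpha ^+ (n + 2).

Let KE : 2^-1 * (3 / 2) `^ nu * (pi * 36 / alpha ^+ 2) * (3 / 4) `^ (- (nu + 1)) *
  (- 3 / alpha) ^+ n * (4 / 3) ^+ n = K.
Proof.
have p34 : (3 / 4) `^ (- (nu + 1)) = (2 / (3 / 2)) `^ nu * (4 / 3) :> R.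
  rewrite opprD powRD; last by apply/implyP => _; rewrite gt_eqF// divr_gt0.
  rewrite [X in _ * X]powR_inv1 ?divr_ge0// invf_div; congr (_ * _).
  rewrite -[- nu]mulN1r powRrM powR_inv1 ?divr_ge0//; congr (_ `^ _).
  by field.
rewrite p34 /K.
have -> : 2 `^ (nu + 3) = 8 * ((2 / (3 / 2)) `^ nu * (3 / 2) `^ nu) :> R.
  rewrite -powRM ?divr_ge0// divfK ?gt_eqF ?divr_gt0//.
  rewrite powRD; last by apply/implyP => _; rewrite pnatr_eq0.
  by rewrite powR_mulrn//; ring.
have -> : (- 3 / alpha) ^+ n = (-1) ^+ n * 3 ^+ n / alpha ^+ n.
  by rewrite expr_div_n -exprMn mulN1r.
have -> : (4 / 3) ^+ n = 4 ^+ n / 3 ^+ n :> R by rewrite expr_div_n.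
have n3 : 3 ^+ n != 0 :> R by rewrite expf_neq0// pnatr_eq0.
have na : alpha ^+ n != 0 by rewrite expf_neq0// gt_eqF.
have a0 : alpha != 0 by rewrite gt_eqF.
rewrite exprD; field.
by rewrite a0 na n3.
Qed.

(** The gain is that [k] occurs only in [k ^_ j] and in a term of an exponential series. The Gamma
    value in the coefficient of I_nu cancels against that of the [theta]-integral up to a rising
    factorial, from which [rising_ffact] removes [k]. *)
Lemma series_coefE k : series_coef k =
  \sum_(j < n.+1) K * 'C(n, j)%:R * 4 ^+ j * rising (nu + 1 + j%:R) (n - j) *
    (k ^_ j)%:R * ((- alpha / 4) ^+ k / k`!%:R).
Proof.
have nu10 : 0 < nu + 1 by rewrite -ltrBlDr sub0r.
have p34 m : (3 / 4) `^ (- (nu + 1 + m%:R)) = (3 / 4) `^ (- (nu + 1)) * (4 / 3) ^+ m :> R.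
  rewrite opprD powRD; last by apply/implyP => _; rewrite gt_eqF// divr_gt0.
  by rewrite powR_invn ?divr_ge0// -exprVn invf_div.
have gam j : besselI_coef nu k * Gamma (nu + 1 + (n - j + k)%:R) =
    rising (nu + 1 + k%:R) (n - j) / k`!%:R.
  rewrite addnC natrD addrA Gamma_rising; last by rewrite ltr_wpDr.
  rewrite /besselI_coef (_ : k%:R + nu + 1 = nu + 1 + k%:R); last ring.
  have G0 : Gamma (nu + 1 + k%:R) != 0 by rewrite gt_eqF// Gamma_gt0// ltr_wpDr.
  have k0 : k`!%:R != 0 :> R by rewrite pnatr_eq0 -lt0n fact_gt0.
  by field; rewrite G0 k0.
transitivity (K * ((- alpha / 4) ^+ k / k`!%:R) *
   \sum_(j < n.+1) 'C(n, j)%:R * (3 ^+ j * (k ^_ j)%:R * rising (nu + 1 + k%:R) (n - j))).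
  rewrite /series_coef /theta_moment !big_distrr /=; apply: eq_bigr => j _.
  rewrite p34.
  (* Taking [j] out of the exponent of [4 / 3] turns [4 ^+ j] into [3 ^+ j]: the case [l = 3] of
     [rising_ffact], whose other side has [l + 1 = 4]. *)
  have h43 : (4 / 3) ^+ (n - j + k) * 4 ^+ j = (4 / 3) ^+ n * (4 / 3) ^+ k * 3 ^+ j :> R.
    rewrite exprD mulrAC -[X in _ = (4 / 3) ^+ X * _ * _](subnK (_ : (j <= n)%N)); last by rewrite -ltnS.
    rewrite exprD (_ : 4 ^+ j = (4 / 3) ^+ j * 3 ^+ j :> R); first ring.
    by rewrite -exprMn divfK// pnatr_eq0.
  have hk : ((alpha / 4) ^+ 2) ^+ k * (- 3 / alpha) ^+ k * (4 / 3) ^+ k = (- alpha / 4) ^+ k.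
    rewrite -!exprMn; congr (_ ^+ k); field.
    by rewrite gt_eqF.
  rewrite -KE -hk exprD.
  transitivity (2^-1 * (3 / 2) `^ nu * (pi * 36 / alpha ^+ 2) * (3 / 4) `^ (- (nu + 1)) *
    (- 3 / alpha) ^+ n * (((alpha / 4) ^+ 2) ^+ k * (- 3 / alpha) ^+ k) * 'C(n, j)%:R * (k ^_ j)%:R *
    ((4 / 3) ^+ (n - j + k) * 4 ^+ j) * (besselI_coef nu k * Gamma (nu + 1 + (n - j + k)%:R))).
    by ring.
  by rewrite h43 gam; ring.
rewrite rising_ffact big_distrr /=; apply: eq_bigr => j _.
rewrite (_ : 3 + 1 = 4 :> R); last ring.
by ring.
Qed.

(** With [s = - alpha z / 4] each falling factorial sums to [s^j e^s], and [4^j s^j = (- alpha z)^j]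
    gives the signs and powers of the Laguerre polynomial. *)
Lemma ccvg_series_coef (z : R[i]) :
  ccvg (fun N => \sum_(k < N) (series_coef k)%:C * z ^+ k)
   (((-1) ^+ n * 3 * pi * 2 `^ (nu + 3) * 4 ^+ n * n`!%:R / alpha ^+ (n + 2))%:C
    * cexp (- (alpha%:C * z / 4)) * laguerre n nu (alpha%:C * z)).
Proof.
set s := - (alpha%:C * z / 4).
have nu10 : 0 < nu + 1 by rewrite -ltrBlDr sub0r.
pose c j : R := K * 'C(n, j)%:R * 4 ^+ j * rising (nu + 1 + j%:R) (n - j).
have sE : s = (- alpha / 4)%:C * z.
  rewrite /s rmorphM rmorphN fmorphV rmorph_nat /=; ring.
have H := @ccvg_sum R 'I_n.+1 (index_enum _) (fun j N => (c j)%:C * \sum_(k < N) (k ^_ j)%:R * (s ^+ k / k`!%:R))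
   (fun j => (c j)%:C * (s ^+ j * cexp s)) (fun j => ccvgZ _ (ccvg_cexp_ffact s j)).
rewrite (_ : (fun N => _) = (fun N => \sum_(j < n.+1) (c j)%:C * \sum_(k < N) (k ^_ j)%:R * (s ^+ k / k`!%:R))); last first.
  apply/funext => N; under [RHS]eq_bigr do rewrite big_distrr /=.
  rewrite exchange_big /=; apply: eq_bigr => k _.
  rewrite series_coefE rmorph_sum /= big_distrl /=; apply: eq_bigr => j _.
  rewrite -/(c j) 2!rmorphM /= rmorph_nat (rmorphM _ ((- alpha / 4) ^+ k)) fmorphV rmorph_nat rmorphXn /=.
  by rewrite sE exprMn; ring.
rewrite (_ : _ * _ * _ = \sum_(j < n.+1) (c j)%:C * (s ^+ j * cexp s))//.
rewrite /laguerre big_distrr /=; apply: eq_bigr => j _.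
have jn : (j <= n)%N by rewrite -ltnS.
have aE : alpha%:C * z = - 4 * s.
  by rewrite /s; field.
rewrite aE exprMn.
have -> : (- 4 : R[i]) ^+ j = ((- 4) ^+ j)%:C by rewrite rmorphXn rmorphN rmorph_nat.
have cE : (-1) ^+ n * 3 * pi * 2 `^ (nu + 3) * 4 ^+ n * n`!%:R / alpha ^+ (n + 2) *
   ((-1) ^+ j * Gamma (n%:R + nu + 1) / ((n - j)`!%:R * Gamma (j%:R + nu + 1) * j`!%:R)) *
   (- 4) ^+ j = c j.
  rewrite (_ : n%:R + nu + 1 = nu + 1 + j%:R + (n - j)%:R); last first.
    by rewrite -{1}(subnK jn) natrD; ring.
  rewrite Gamma_rising; last by rewrite ltr_wpDr.
  rewrite (_ : j%:R + nu + 1 = nu + 1 + j%:R); last ring.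
  have G0 : Gamma (nu + 1 + j%:R) != 0 by rewrite gt_eqF// Gamma_gt0// ltr_wpDr.
  have k0 m : m`!%:R != 0 :> R by rewrite pnatr_eq0 -lt0n fact_gt0.
  rewrite -(bin_fact jn) !natrM /c /K (_ : (- 4) ^+ j = (-1) ^+ j * 4 ^+ j :> R); last first.
    by rewrite -exprMn mulN1r.
  have s1 : (-1) ^+ j * (-1) ^+ j = 1 :> R by rewrite -exprMn mulrNN mulr1 expr1n.
  have na : alpha ^+ (n + 2) != 0 by rewrite expf_neq0// gt_eqF.
  transitivity (((-1) ^+ j * (-1) ^+ j) * ((-1) ^+ n * 3 * pi * 2 `^ (nu + 3) * 4 ^+ n / alpha ^+ (n + 2) * 'C(n, j)%:R * 4 ^+ j *
     rising (nu + 1 + j%:R) (n - j))); last by rewrite s1 mul1r.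
  field.
  by rewrite na G0 !k0.
rewrite -cE !rmorphM /=; ring.
Qed.

End LaguerreSeries.

(** * Integrating out one variable of a weight *)

Section WeightedFubini.
Context d1 d2 (T1 : measurableType d1) (T2 : measurableType d2) (R : realType).
Variable m1 : {sigma_finite_measure set T1 -> \bar R}.
Variable m2 : {sigma_finite_measure set T2 -> \bar R}.
Variable W : T1 * T2 -> R.
Hypothesis W0 : forall p, 0 <= W p.
Hypothesis Wi : (m1 \x m2)%E.-integrable setT (EFin \o W).

Definition weight_margin x := \int[m2]_y W (x, y).

Lemma measurable_weight_margin : measurable_fun setT weight_margin.
Proof.
apply: measurableT_comp => //.
apply: (measurable_fun_fubini_tonelli_F (EFin \o W)) => //.
by apply: measurable_int Wi.
Qed.

Lemma weight_margin_ge0 x : 0 <= weight_margin x.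
Proof. by apply: Rintegral_ge0 => y _. Qed.

Section real.
Variable h : T1 -> R.
Hypothesis mh : measurable_fun setT h.
Hypothesis hWi : (m1 \x m2)%E.-integrable setT (EFin \o (fun p => h p.1 * W p)).

Let f : T1 * T2 -> \bar R := EFin \o (fun p => h p.1 * W p).
Let g : T1 -> \bar R := EFin \o (fun x => h x * weight_margin x).

Let mg : measurable_fun setT g.
Proof. by apply/measurable_EFinP; apply: measurable_funM => //; exact: measurable_weight_margin. Qed.

(** Equality can fail on the null set of [x] whose slice of [W] is not integrable, where
    [weight_margin] is the default value of [fine]. In the application the origin is such a point
    when [nu <= 0]. *)
Let fg : ae_eq m1 setT (fubini_F m2 f) g.
Proof.
have := ae_integrable1 Wi; apply: filterS => x Wx _.
rewrite /fubini_F /f /g /=.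
under eq_integral do rewrite EFinM.
rewrite integralZl// EFinM /weight_margin /Rintegral fineK//.
exact: (integrable_fin_num measurableT Wx).
Qed.

Lemma integrable_weight_margin : m1.-integrable setT g.
Proof.
apply/integrableP; split => //.
have /integrableP[mF] := integrable_fubini_F hWi.
congr (_ < _)%E; apply: ae_eq_integral => //.
- exact: measurableT_comp.
- exact: measurableT_comp.
- by move: fg; apply: filterS => x H _; rewrite H.
Qed.

Hypothesis hWi2 : forall y, m1.-integrable setT (EFin \o (fun x => h x * W (x, y))).

Lemma Rintegral_weight_margin :
  \int[m1]_x (h x * weight_margin x) = \int[m2]_y \int[m1]_x (h x * W (x, y)).
Proof.
rewrite /Rintegral; congr fine.
transitivity (\int[m1]_x fubini_F m2 f x)%E.
  apply: ae_eq_integral => //; last by apply: ae_eq_sym.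
  exact: (measurable_fubini_F hWi).
rewrite integral12_prod_meas1// -integral21_prod_meas1//.
apply: eq_integral => y _; rewrite fineK//.
exact: (integrable_fin_num measurableT (hWi2 y)).
Qed.

End real.

Section complex.
Variable h : T1 -> R[i].
Hypothesis mh1 : measurable_fun setT (fun x => complex.Re (h x)).
Hypothesis mh2 : measurable_fun setT (fun x => complex.Im (h x)).
Hypothesis hWi : cint_able (m1 \x m2)%E (fun p => h p.1 * (W p)%:C).

Let hWi1 : (m1 \x m2)%E.-integrable setT (EFin \o (fun p => complex.Re (h p.1) * W p)).
Proof.
have [H _] := hWi; rewrite (_ : EFin \o _ = EFin \o (fun p => complex.Re (h p.1 * (W p)%:C)))//.
by apply/funext => p /=; rewrite complex_ReM /= mulr0 subr0.
Qed.

Let hWi2 : (m1 \x m2)%E.-integrable setT (EFin \o (fun p => complex.Im (h p.1) * W p)).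
Proof.
have [_ H] := hWi; rewrite (_ : EFin \o _ = EFin \o (fun p => complex.Im (h p.1 * (W p)%:C)))//.
by apply/funext => p /=; rewrite complex_ImM /= mulr0 add0r.
Qed.

Lemma cint_able_weight_margin : cint_able m1 (fun x => h x * (weight_margin x)%:C).
Proof.
split.
  have := integrable_weight_margin mh1 hWi1.
  congr (integrable _ _ _); apply/funext => x /=.
  by rewrite complex_ReM /= mulr0 subr0.
have := integrable_weight_margin mh2 hWi2.
congr (integrable _ _ _); apply/funext => x /=.
by rewrite complex_ImM /= mulr0 add0r.
Qed.

Hypothesis hWy : forall y, cint_able m1 (fun x => h x * (W (x, y))%:C).

(** Fubini with the integral over the first variable moved inside: in the application the planar
    integral is then taken at fixed [theta], where it is Gaussian. *)
Lemma cint_weight_margin :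
  cint m1 (fun x => h x * (weight_margin x)%:C) =
  cint m2 (fun y => cint m1 (fun x => h x * (W (x, y))%:C)).
Proof.
have e1 x a : complex.Re (h x * a%:C) = complex.Re (h x) * a.
  by rewrite complex_ReM /= mulr0 subr0.
have e2 x a : complex.Im (h x * a%:C) = complex.Im (h x) * a.
  by rewrite complex_ImM /= mulr0 add0r.
have E1 (k : T1 -> R) : (fun x => complex.Re (h x * (k x)%:C)) = (fun x => complex.Re (h x) * k x).
  by apply/funext => x; exact: e1.
have E2 (k : T1 -> R) : (fun x => complex.Im (h x * (k x)%:C)) = (fun x => complex.Im (h x) * k x).
  by apply/funext => x; exact: e2.
rewrite /cint /= E1 E2.
rewrite (Rintegral_weight_margin mh1 hWi1); last first.
  by move=> y; have [H _] := hWy y; rewrite -E1.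
rewrite (Rintegral_weight_margin mh2 hWi2); last first.
  by move=> y; have [_ H] := hWy y; rewrite -E2.
congr (_ +i* _); apply: eq_Rintegral => y _.
  by rewrite (E1 (fun x => W (x, y))).
by rewrite (E2 (fun x => W (x, y))).
Qed.

End complex.
End WeightedFubini.

(** * Complex measurability and the planar measure *)

Section ComplexMeasurability.
Context d (T : measurableType d) (R : realType).
Implicit Types f g : T -> R[i].

Definition cmeasurable f :=
  measurable_fun setT (fun x => complex.Re (f x)) /\
  measurable_fun setT (fun x => complex.Im (f x)).

Lemma cmeasurableM f g : cmeasurable f -> cmeasurable g -> cmeasurable (fun x => f x * g x).
Proof.
move=> [f1 f2] [g1 g2]; split.
  under eq_fun do rewrite complex_ReM.
  by apply: measurable_funB; exact: measurable_funM.
under eq_fun do rewrite complex_ImM.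
by apply: measurable_funD; exact: measurable_funM.
Qed.

Lemma cmeasurable_cst (z : R[i]) : cmeasurable (fun=> z).
Proof. by split; exact: measurable_cst. Qed.

Lemma cmeasurableX f n : cmeasurable f -> cmeasurable (fun x => f x ^+ n).
Proof.
move=> mf; elim: n => [|n IH].
  by under eq_fun do rewrite expr0; exact: cmeasurable_cst.
by under eq_fun do rewrite exprS; exact: cmeasurableM.
Qed.

Lemma cmeasurable_real (k : T -> R) : measurable_fun setT k -> cmeasurable (fun x => (k x)%:C).
Proof. by move=> mk; split => //=; exact: measurable_cst. Qed.

End ComplexMeasurability.

(* A constant of its own, so that sigma-finiteness can be attached to it. *)
Definition plane_measure (R : realType) :
  set (measurableTypeR R * measurableTypeR R)%type -> \bar R := @planar_measure R.

HB.instance Definition _ (R : realType) := Measure.on (@plane_measure R).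

Lemma plane_measure_sigma_finite (R : realType) : sigma_finite setT (@plane_measure R).
Proof.
pose I n : set (measurableTypeR R) := `[- n%:R, n%:R]%classic.
exists (fun n => I n `*` I n).
  apply/seteqP; split => // -[x y] _.
  exists (Num.bound (`|x| + `|y|)) => //.
  have xy : `|x| + `|y| < (Num.bound (`|x| + `|y|))%:R.
    by apply: archi_boundP; rewrite addr_ge0.
  split; rewrite /I /= in_itv/= -ler_norml (le_trans _ (ltW xy))//.
    by rewrite lerDl.
  by rewrite lerDr.
move=> n; have mI : measurable (I n) by rewrite /I.
split; first exact: measurableX.
rewrite /plane_measure /planar_measure /= product_measure1E//.
rewrite /= /I lebesgue_measure_itv/=.
by case: ifP => _; rewrite ?mule0// ltry.
Qed.

HB.instance Definition _ (R : realType) := Measure_isSigmaFinite.Build _ _ _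
  (@plane_measure R) (@plane_measure_sigma_finite R).

Lemma plane_measure1 (R : realType) p : @plane_measure R [set p] = 0%E.
Proof.
case: p => x y.
rewrite (_ : [set (x, y)] = [set x] `*` [set y]).
  rewrite /plane_measure /planar_measure /= product_measure1E//.
  by rewrite [X in (X * _)%E]lebesgue_measure_set1 mul0e.
by apply/seteqP; split => [_ ->//|[a b] /= [-> ->]].
Qed.

(** * K_nu as the margin of a kernel on plane times line *)

Section PlanarKernel.
Context {R : realType}.
Notation mu := (@lebesgue_measure R).
Local Notation cabs := ComplexField.Normc.normc.
Local Notation pm := (@plane_measure R).
Local Notation plane := (measurableTypeR R * measurableTypeR R)%type.
Variables (alpha nu : R).
Hypotheses (alpha0 : 0 < alpha) (nu1 : -1 < nu).
Implicit Types (p : plane) (th : R).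

Definition toC p : R[i] := p.1 +i* p.2.

Lemma cmeasurable_toC : cmeasurable (fun p => toC p).
Proof. by split => /=; [exact: measurable_fst|exact: measurable_snd]. Qed.

Lemma cmeasurable_conj_toC : cmeasurable (fun p : plane => p.1 -i* p.2).
Proof.
split => /=; first exact: measurable_fst.
by apply: measurableT_comp => //; exact: measurable_snd.
Qed.

Lemma measurable_normc_toC : measurable_fun setT (fun p => cabs (toC p)).
Proof.
rewrite /toC /=; apply: measurableT_comp.
  by apply: continuous_measurable_fun; exact: sqrt_continuous.
by apply: measurable_funD; apply: measurable_funX; [exact: measurable_fst|exact: measurable_snd].
Qed.

Lemma normc_toC_sqr p : cabs (toC p) ^+ 2 = p.1 ^+ 2 + p.2 ^+ 2.
Proof. by rewrite normc_sqr. Qed.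

(** [alpha^2 / 36 * |u|^2] is [x^2 / 4] at the argument [x = alpha |u| / 3] of K_nu. *)
Definition besselK_kernel (pt : plane * measurableTypeR R) : R :=
  besselK_weight nu (alpha ^+ 2 / 36 * (pt.1.1 ^+ 2 + pt.1.2 ^+ 2)) pt.2.

Lemma measurable_kernel (c : R) (s l : R) :
  measurable_fun setT (fun pt : plane * measurableTypeR R =>
    expR (s * pt.2 - l * expR pt.2 - c * (pt.1.1 ^+ 2 + pt.1.2 ^+ 2) * expR (- pt.2))).
Proof.
have m2 : measurable_fun setT (fun pt : plane * measurableTypeR R => pt.2) by exact: measurable_snd.
have mN2 : measurable_fun setT (fun pt : plane * measurableTypeR R => - pt.2).
  exact: measurableT_comp.
have m11 : measurable_fun setT (fun pt : plane * measurableTypeR R => pt.1.1).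
  by apply: (measurableT_comp measurable_fst); exact: measurable_fst.
have m12 : measurable_fun setT (fun pt : plane * measurableTypeR R => pt.1.2).
  by apply: (measurableT_comp measurable_snd); exact: measurable_fst.
apply: measurableT_comp; first exact: measurable_expR.
apply: measurable_funB; first apply: measurable_funB.
- exact: measurable_funM.
- by apply: measurable_funM => //; apply: measurableT_comp; first exact: measurable_expR.
- apply: measurable_funM.
    by apply: measurable_funM => //; apply: measurable_funD; exact: measurable_funX.
  exact: (measurableT_comp (@measurable_expR R) mN2).
Qed.

Lemma besselK_kernelE : besselK_kernel = (fun pt => expR (nu * pt.2 - 1 * expR pt.2 -
   alpha ^+ 2 / 36 * (pt.1.1 ^+ 2 + pt.1.2 ^+ 2) * expR (- pt.2))).
Proof. by apply/funext => pt; rewrite /besselK_kernel /besselK_weight mul1r. Qed.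

Lemma measurable_besselK_kernel : measurable_fun setT besselK_kernel.
Proof. by rewrite besselK_kernelE; exact: measurable_kernel. Qed.

Lemma besselK_kernel_ge0 pt : 0 <= besselK_kernel pt.
Proof. exact: expR_ge0. Qed.

(** What is left of the kernel once [e^(2 alpha |u| / 9)] has been paid for with [8 / 9] of
    [expR th] and half of the Gaussian exponent. *)
Let majorant (pt : plane * measurableTypeR R) : R :=
  expR (nu * pt.2 - 1 / 9 * expR pt.2 -
    alpha ^+ 2 / 72 * (pt.1.1 ^+ 2 + pt.1.2 ^+ 2) * expR (- pt.2)).

(* AM-GM: [2 alpha / 9 * r <= 8 / 9 * e^th + alpha^2 / 72 * r^2 * e^(- th)] *)
Lemma besselK_kernel_le p th :
  expR (2 * alpha / 9 * cabs (toC p)) * besselK_kernel (p, th) <= majorant (p, th).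
Proof.
rewrite besselK_kernelE /majorant -expRD ler_expR; set r := cabs (toC p).
rewrite /= -normc_toC_sqr -/r; set a := expR th.
have a0 : 0 < a by exact: expR_gt0.
have -> : expR (- th) = a^-1 by rewrite expRN.
have h : 0 <= 8 / 9 * a^-1 * (a - alpha / 8 * r) ^+ 2.
  by rewrite mulr_ge0 ?sqr_ge0// mulr_ge0 ?invr_ge0 ?divr_ge0// ltW.
have e : 8 / 9 * a^-1 * (a - alpha / 8 * r) ^+ 2 =
    8 / 9 * a + alpha ^+ 2 / 72 * r ^+ 2 * a^-1 - 2 * alpha / 9 * r.
  by field; rewrite gt_eqF.
rewrite e in h; lra.
Qed.

Let majorantE p th : majorant (p, th) = expR (nu * th - 1 / 9 * expR th) *
  (gauss_weight 0 (alpha ^+ 2 / 72 * expR (- th)) p.1 *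
   gauss_weight 0 (alpha ^+ 2 / 72 * expR (- th)) p.2).
Proof. by rewrite /majorant /gauss_weight -!expRD /=; congr expR; ring. Qed.

(** By Tonelli the plane is integrated first, a Gaussian of mass [72 pi / alpha^2 * e^th]. The extra
    [e^th] raises the exponent to [nu + 1], which is positive because [nu > -1]. *)
Lemma integrable_majorant : (pm \x mu)%E.-integrable setT (EFin \o majorant).
Proof.
have mM : measurable_fun setT (EFin \o majorant).
  by apply/measurable_EFinP; exact: measurable_kernel.
apply: (proj2 (@integrable21ltyP _ _ _ _ R pm mu _ mM)).
have nu10 : 0 < nu + 1 by rewrite -ltrBlDr sub0r.
have l9 : 0 < 1 / 9 :> R by rewrite divr_gt0.
have a2 : 0 < alpha ^+ 2 by rewrite exprn_gt0.
have H th : (\int[pm]_p `|(EFin \o majorant) (p, th)| =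
    (pi * 72 / alpha ^+ 2 * expR ((nu + 1) * th - 1 / 9 * expR th))%:E)%E.
  set c := alpha ^+ 2 / 72 * expR (- th).
  have c0 : 0 < c by rewrite /c mulr_gt0 ?expR_gt0// divr_gt0.
  have i0 : mu.-integrable [set: R] (EFin \o (gauss_weight 0 c)).
    have := integrable_gauss_moment 0 0 c0.
    by congr (integrable _ _ _); apply/funext => x; rewrite /= expr0 mul1r.
  have g0 : \int[mu]_x gauss_weight 0 c x = Num.sqrt (pi / c).
    have := gauss_moment0 0 c0; rewrite expr0n /= mul0r expR0 mulr1 => <-.
    by apply: eq_Rintegral => x _; rewrite expr0 mul1r.
  have iP := @integrable_prodM _ _ _ _ R mu mu _ _ i0 i0.
  transitivity (\int[pm]_p ((expR (nu * th - 1 / 9 * expR th))%:E *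
      (gauss_weight 0 c p.1 * gauss_weight 0 c p.2)%:E))%E.
    by apply: eq_integral => p _; rewrite /= majorantE ger0_norm ?EFinM// !mulr_ge0 ?expR_ge0.
  rewrite integralZl//.
  rewrite -[X in (_ * X)%E]fineK; last exact: (integrable_fin_num measurableT iP).
  have := @Rintegral_prodM _ _ _ _ R mu mu _ _ i0 i0.
  rewrite /Rintegral => ->; rewrite -EFinM; congr EFin.
  move: g0; rewrite /Rintegral => ->.
  rewrite -expr2 sqr_sqrtr; last by rewrite divr_ge0 ?pi_ge0// ltW.
  rewrite (_ : (nu + 1) * th - 1 / 9 * expR th = th + (nu * th - 1 / 9 * expR th)); last ring.
  rewrite expRD /c expRN; field.
  by rewrite !gt_eqF// expR_gt0.
under eq_integral do rewrite H.
apply: (integrable_lty measurableT).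
exact: (@integrableZl _ _ _ mu [set: R] measurableT _ _ (integrable_expexp nu10 l9)).
Qed.

Lemma integrable_exp_kernel : (pm \x mu)%E.-integrable setT
  (EFin \o (fun pt => expR (2 * alpha / 9 * cabs (toC pt.1)) * besselK_kernel pt)).
Proof.
apply: (le_integrable measurableT _ _ integrable_majorant).
  apply/measurable_EFinP; apply: measurable_funM; last exact: measurable_besselK_kernel.
  apply: measurableT_comp; first exact: measurable_expR.
  apply: measurable_funM => //.
  by apply: (measurableT_comp measurable_normc_toC); exact: measurable_fst.
move=> [p th] _ /=; rewrite lee_fin ger0_norm ?mulr_ge0 ?expR_ge0// ger0_norm ?expR_ge0//.
exact: besselK_kernel_le.
Qed.

Lemma integrable_kernel_bound (k : plane * measurableTypeR R -> R) (C : R) :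
  measurable_fun setT k ->
  (forall pt, `|k pt| <= C * (expR (2 * alpha / 9 * cabs (toC pt.1)) * besselK_kernel pt)) ->
  (pm \x mu)%E.-integrable setT (EFin \o k).
Proof.
move=> mk kC.
have iC := @integrableZl _ _ _ (pm \x mu)%E setT measurableT C _ integrable_exp_kernel.
apply: (le_integrable measurableT _ _ iC).
  exact/measurable_EFinP.
move=> pt _ /=; rewrite lee_fin (le_trans (kC pt))//.
exact: ler_norm.
Qed.

Lemma integrable_besselK_kernel : (pm \x mu)%E.-integrable setT (EFin \o besselK_kernel).
Proof.
apply: (@integrable_kernel_bound _ 1); first exact: measurable_besselK_kernel.
move=> pt; rewrite mul1r ger0_norm ?besselK_kernel_ge0// ler_peMl ?besselK_kernel_ge0//.
have a0 := ltW alpha0.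
by rewrite -expR0 ler_expR mulr_ge0 ?normc_ge0// divr_ge0// mulr_ge0.
Qed.

Definition besselK_margin p : R := weight_margin mu besselK_kernel p.

Lemma besselK_marginE u : u != 0 ->
  cabs u `^ nu * besselK nu (alpha * cabs u / 3) =
  (alpha / 3) `^ (- nu) * (2 `^ nu / 2) * besselK_margin (complex.Re u, complex.Im u).
Proof.
move=> u0; have r0 := normc_gt0 u0.
have x0 : 0 < alpha * cabs u / 3 by rewrite divr_gt0// mulr_gt0.
have := besselKE nu x0.
rewrite (_ : alpha * cabs u / 3 = (alpha / 3) * cabs u); last by rewrite mulrAC.
have a3 : 0 < alpha / 3 by rewrite divr_gt0.
rewrite (powRM _ (ltW a3) (ltW r0)).
have -> : (alpha / 3 * cabs u) ^+ 2 / 4 = alpha ^+ 2 / 36 * (complex.Re u ^+ 2 + complex.Im u ^+ 2).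
  by rewrite -normc_sqr; field.
rewrite -[X in _ = _ * X]/(besselK_margin (complex.Re u, complex.Im u)) => H.
have p0 : (alpha / 3) `^ nu != 0 by rewrite gt_eqF// powR_gt0.
by apply: (mulfI p0); rewrite powRN !mulrA H mulfV// mul1r.
Qed.

End PlanarKernel.

(** * Dominated convergence and null points *)

Section ComplexDominated.
Context d (T : measurableType d) (R : realType) (m : {measure set T -> \bar R}).
Local Notation cabs := ComplexField.Normc.normc.

Let real_dominated (F : nat -> T -> R) (f g : T -> R) :
  (forall N, m.-integrable setT (EFin \o F N)) ->
  (forall x, F N x @[N --> \oo] --> f x) ->
  (forall N x, `|F N x| <= g x) -> m.-integrable setT (EFin \o g) ->
  m.-integrable setT (EFin \o f) /\
  (\int[m]_x F N x @[N --> \oo] --> \int[m]_x f x).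
Proof.
move=> Fi Ff Fg gi.
have mF N : measurable_fun setT (F N) by apply/measurable_EFinP; apply: measurable_int (Fi N).
have mf : measurable_fun setT f.
  by apply: (measurable_fun_cvg mF) => x _; exact: Ff.
have mFE N : measurable_fun setT (EFin \o F N) by apply/measurable_EFinP.
have mfE : measurable_fun setT (EFin \o f) by apply/measurable_EFinP.
have cF : {ae m, forall x, setT x -> (EFin \o F N) x @[N --> \oo] --> (EFin \o f) x}.
  by apply: aeW => x _; apply: cvg_EFin; [near=> N|exact: Ff].
have bF : {ae m, forall x N, setT x -> (`|(EFin \o F N) x| <= (EFin \o g) x)%E}.
  by apply: aeW => x N _; rewrite /= lee_fin.
have [fi _ Hc] := @dominated_convergence _ _ _ m setT measurableT
  (fun N => EFin \o F N) (EFin \o f) (EFin \o g) mFE mfE cF gi bF.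
split => //.
apply: fine_cvg; rewrite fineK; last exact: (integrable_fin_num measurableT fi).
exact: Hc.
Unshelve. all: by end_near. Qed.

Lemma cint_dominated (F : nat -> T -> R[i]) (f : T -> R[i]) (g : T -> R) :
  (forall N, cint_able m (F N)) ->
  (forall x, ccvg (fun N => F N x) (f x)) ->
  (forall N x, cabs (F N x) <= g x) -> m.-integrable setT (EFin \o g) ->
  cint_able m f /\ ccvg (fun N => cint m (F N)) (cint m f).
Proof.
move=> Fi Ff Fg gi.
have [r1 r2] := real_dominated (fun N => (Fi N).1) (fun x => (Ff x).1)
  (fun N x => le_trans (normc_Re _) (Fg N x)) gi.
have [i1 i2] := real_dominated (fun N => (Fi N).2) (fun x => (Ff x).2)
  (fun N x => le_trans (normc_Im _) (Fg N x)) gi.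
by split; split.
Qed.

(** [f] is [g] plus a multiple of the indicator of [p], which yields its measurability along with
    the value of its integral. *)
Let real_ae (f g : T -> R) (p : T) : measurable [set p] -> m [set p] = 0%E ->
  (forall x, x != p -> f x = g x) -> m.-integrable setT (EFin \o g) ->
  m.-integrable setT (EFin \o f) /\ \int[m]_x f x = \int[m]_x g x.
Proof.
move=> mp p0 fg gi.
pose h x := (f p - g p) * \1_[set p] x.
have i1 : m.-integrable setT (EFin \o \1_[set p]).
  apply/integrableP; split; first by apply/measurable_EFinP; exact: measurable_indic.
  under eq_integral do rewrite /= ger0_norm ?indicE//.
  by rewrite -[X in (X < _)%E]/(\int[m]_(x in setT) (\1_[set p] x)%:E)%E integral_indic// setIT p0 ltry.
have hi : m.-integrable setT (EFin \o h).
  apply: (@integrableZl _ _ _ m setT measurableT (f p - g p) (EFin \o \1_[set p])).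
  exact: i1.
have fE : f = fun x => g x + h x.
  apply/funext => x; rewrite /h indicE; have [->|xp] := eqVneq x p.
    by rewrite mem_set// mulr1 addrC subrK.
  by rewrite memNset ?mulr0 ?addr0 ?fg// => /eqP; rewrite (negbTE xp).
split; first by rewrite fE; exact: (integrableD measurableT gi hi).
rewrite fE RintegralD// -[RHS]addr0; congr (_ + _).
rewrite /h RintegralZl//.
by rewrite /Rintegral integral_indic// setIT p0 /= mulr0.
Qed.

Lemma cint_ae (f g : T -> R[i]) (p : T) : measurable [set p] -> m [set p] = 0%E ->
  (forall x, x != p -> f x = g x) -> cint_able m g ->
  cint_able m f /\ cint m f = cint m g.
Proof.
move=> mp p0 fg [g1 g2].
have [f1 e1] := real_ae mp p0 (fun x xp => congr1 (fun z => complex.Re z) (fg x xp)) g1.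
have [f2 e2] := real_ae mp p0 (fun x xp => congr1 (fun z => complex.Im z) (fg x xp)) g2.
by split => //; rewrite /cint e1 e2.
Qed.

End ComplexDominated.

(** * The Bessel-Laguerre integral *)

Section BesselLaguerreIntegral.
Context {R : realType}.
Notation mu := (@lebesgue_measure R).
Local Notation cabs := ComplexField.Normc.normc.
Local Notation plane := (measurableTypeR R * measurableTypeR R)%type.
Local Notation pm := (@plane_measure R).
Variables (alpha nu : R) (n : nat).
Hypotheses (alpha0 : 0 < alpha) (nu1 : -1 < nu).
Implicit Types (p : plane).

Local Notation W := (besselK_kernel alpha nu).
Local Notation kappa := (besselK_margin alpha nu).

Let decay p : R := expR (- (1 / 6) * alpha * p.1).

Definition monomial k p : R[i] := toC p ^+ n * (p.1 -i* p.2) ^+ k * (decay p)%:C.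

Let measurable_decay : measurable_fun setT decay.
Proof.
apply: measurableT_comp; first exact: measurable_expR.
by apply: measurable_funM => //; exact: measurable_fst.
Qed.

Let cmeasurable_monomial k : cmeasurable (monomial k).
Proof.
apply: cmeasurableM; last exact: cmeasurable_real.
apply: cmeasurableM; apply: cmeasurableX; first exact: cmeasurable_toC.
exact: cmeasurable_conj_toC.
Qed.

Let normc_conj p : cabs (p.1 -i* p.2) = cabs (toC p).
Proof. by rewrite /= sqrrN. Qed.

Let decay_le p : decay p <= expR (alpha / 6 * cabs (toC p)).
Proof.
rewrite ler_expR.
have h : - p.1 <= cabs (toC p).
  by apply: le_trans (normc_Re (toC p)); rewrite -normrN ler_norm.
have a6 : 0 <= alpha / 6 by rewrite divr_ge0// ltW.
have := ler_wpM2l a6 h; lra.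
Qed.

Let expn_le (D r : R) m : 0 < D -> 0 <= r -> r ^+ m <= m`!%:R / D ^+ m * expR (D * r).
Proof.
move=> D0 r0; have := normX_le_expR (D * r) m.
rewrite (ger0_norm (mulr_ge0 (ltW D0) r0)) exprMn mulrAC ler_pdivlMr ?exprn_gt0// mulrC.
by [].
Qed.

Lemma normc_monomial_le k p (D : R) : 0 < D -> cabs (monomial k p) <=
  (n + k)`!%:R / D ^+ (n + k) * expR ((D + alpha / 6) * cabs (toC p)).
Proof.
move=> D0; rewrite /monomial !ComplexField.Normc.normcM !normcX normc_conj cabs_real ?expR_ge0//.
rewrite -exprD; set r := cabs (toC p).
have dr : decay p <= expR (alpha / 6 * r) := decay_le p.
have r0 : 0 <= r by exact: normc_ge0.
apply: (le_trans (ler_pM _ _ (expn_le (n + k) D0 r0) dr)).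
- by rewrite exprn_ge0.
- exact: expR_ge0.
by rewrite -[leLHS]mulrA -expRD -mulrDl.
Qed.

Let cint_able_monomial_kernel k :
  cint_able (pm \x mu)%E (fun pt => monomial k pt.1 * (W pt)%:C).
Proof.
have [m1 m2] := cmeasurable_monomial k.
have mW := measurable_besselK_kernel alpha nu.
have bnd pt : cabs (monomial k pt.1 * (W pt)%:C) <=
    (n + k)`!%:R / (alpha / 18) ^+ (n + k) * (expR (2 * alpha / 9 * cabs (toC pt.1)) * W pt).
  rewrite ComplexField.Normc.normcM cabs_real ?besselK_kernel_ge0// mulrA.
  rewrite ler_wpM2r ?besselK_kernel_ge0//.
  (* [alpha / 18] is what [alpha / 6] leaves of the admissible rate [2 alpha / 9]. *)
  have a18 : 0 < alpha / 18 by rewrite divr_gt0.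
  by rewrite (_ : 2 * alpha / 9 = alpha / 18 + alpha / 6) ?normc_monomial_le//; field.
split; apply: (integrable_kernel_bound alpha0 nu1 _ (fun pt => le_trans _ (bnd pt))).
- under eq_fun do rewrite complex_ReM /= mulr0 subr0.
  apply: measurable_funM => //.
  exact: (measurableT_comp m1 measurable_fst).
- by move=> pt; exact: normc_Re.
- under eq_fun do rewrite complex_ImM /= mulr0 add0r.
  apply: measurable_funM => //.
  exact: (measurableT_comp m2 measurable_fst).
- by move=> pt; exact: normc_Im.
Qed.

Let cc th : R := alpha ^+ 2 / 36 * expR (- th).

Let cc0 th : 0 < cc th.
Proof. by rewrite mulr_gt0 ?expR_gt0// divr_gt0// exprn_gt0. Qed.

Let monomial_kernelE k th : (fun p => monomial k p * (W (p, th))%:C) =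
  (fun p => (expR (nu * th - expR th))%:C *
    ((p.1 +i* p.2) ^+ n * (p.1 -i* p.2) ^+ k * (planar_weight (alpha / 6) (cc th) p)%:C)).
Proof.
apply/funext => p; rewrite /monomial mulrCA -mulrA -!rmorphM -/(toC p); congr (_ * _%:C).
rewrite /decay /besselK_kernel /besselK_weight /planar_weight /gauss_weight -!expRD /cc.
by congr expR => /=; field.
Qed.

Let cint_able_monomial_slice k th : cint_able pm (fun p => monomial k p * (W (p, th))%:C).
Proof.
rewrite monomial_kernelE; apply: cint_ableZ.
exact: (cint_able_planar (alpha / 6) (cc0 th) n k).
Qed.

Let cint_monomial_slice k th : cint pm (fun p => monomial k p * (W (p, th))%:C) =
  (expR (nu * th - expR th) * (pi / cc th * expR ((alpha / 6) ^+ 2 / (4 * cc th)) *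
    (- 3 / alpha) ^+ (n + k) * moment_poly (expR th) n k))%:C.
Proof.
have e0 : expR th != 0 by rewrite gt_eqF// expR_gt0.
have a0 : alpha != 0 by rewrite gt_eqF.
rewrite monomial_kernelE cintZ; last exact: (cint_able_planar (alpha / 6) (cc0 th) n k).
rewrite (rmorphM _ (expR (nu * th - expR th))); congr (_ * _).
apply: (@cint_planar R (alpha / 6) (cc th) (cc0 th) (- 3 / alpha) (expR th) n k).
  by rewrite /cc expRN; field; rewrite e0 a0.
by rewrite /cc expRN; field; rewrite e0 a0.
Qed.

Lemma cint_monomial k :
  cint_able pm (fun p => monomial k p * (kappa p)%:C) /\
  cint pm (fun p => monomial k p * (kappa p)%:C) = (theta_moment alpha nu n k)%:C.
Proof.
have [m1 m2] := cmeasurable_monomial k.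
have Wi := integrable_besselK_kernel alpha0 nu1.
have hWi := cint_able_monomial_kernel k.
have W0 := besselK_kernel_ge0 alpha nu.
split; first exact: (cint_able_weight_margin W0 Wi m1 m2 hWi).
rewrite [LHS](cint_weight_margin W0 Wi m1 m2 hWi (cint_able_monomial_slice k)).
have nu10 : 0 < nu + 1 by rewrite -ltrBlDr sub0r.
have l34 : 0 < 3 / 4 :> R by rewrite divr_gt0.
pose C := pi * 36 / alpha ^+ 2 * (- 3 / alpha) ^+ (n + k).
pose s j : R := nu + 1 + (n - j + k)%:R.
pose coef j : R := C * ('C(n, j)%:R * ((k ^_ j)%:R * 4 ^+ j)).
have s0 j : 0 < s j by rewrite ltr_wpDr.
have E th : cint pm (fun p => monomial k p * (W (p, th))%:C) =
    \sum_(j < n.+1) (coef j)%:C * (expR (s j * th - 3 / 4 * expR th))%:C.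
  rewrite cint_monomial_slice /moment_poly !big_distrr /= rmorph_sum; apply: eq_bigr => j _.
  rewrite -rmorphM; congr (_%:C).
  have a0 : alpha != 0 by rewrite gt_eqF.
  have e0 : expR th != 0 by rewrite gt_eqF// expR_gt0.
  have -> : (alpha / 6) ^+ 2 / (4 * cc th) = 1 / 4 * expR th.
    by rewrite /cc expRN; field; rewrite e0 a0.
  (* On the right, [expR th] comes from [pi / c], [1 / 4 * expR th] from the completed square, and
     the power from [moment_poly]; together they form the integrand of a Gamma value at [s j]. *)
  have -> : expR (s j * th - 3 / 4 * expR th) = expR (nu * th - expR th) * expR th *
      expR (1 / 4 * expR th) * expR th ^+ (n - j + k).
    rewrite -expRM_natl -!expRD /s; congr expR; by field.
  rewrite /cc expRN /coef /C; field.
  by rewrite e0 a0.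
rewrite (_ : (fun th => cint _ _) = (fun th => \sum_(j < n.+1) (coef j)%:C * (expR (s j * th - 3 / 4 * expR th))%:C)); last exact/funext.
have ei j := integrable_expexp (s0 j) l34.
rewrite (@cint_sum _ _ _ mu n.+1 (fun j th => (coef j)%:C * (expR (s j * th - 3 / 4 * expR th))%:C)); last first.
  by move=> j; apply: cint_ableZ; exact: (cint_able_real (ei j)).
rewrite /theta_moment big_distrr /= rmorph_sum; apply: eq_bigr => j _.
rewrite cintZ; last exact: (cint_able_real (ei j)).
rewrite cint_real integral_expexp// -rmorphM; congr (_%:C).
by rewrite /coef /C /s; ring.
Qed.

Variable z : R[i].

Let q : R := (alpha / 4) ^+ 2.

Let q0 : 0 < q.
Proof. by rewrite exprn_gt0// divr_gt0. Qed.

(** [(w / 2)^2] for the argument [w] of I_nu; squaring has removed the roots. *)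
Definition bessel_arg p : R[i] := q%:C * (z * (p.1 -i* p.2)).

Definition bessel_partial N p : R[i] :=
  \sum_(k < N) ((q ^+ k * besselI_coef nu k)%:C * z ^+ k) * (monomial k p * (kappa p)%:C).

(** Away from the origin, the cancelled integrand up to the constant [2^-1 * (3 / 2)^nu], with
    [|u|^nu K_nu] expressed by the margin of the kernel. *)
Definition bessel_limit p : R[i] :=
  monomial 0 p * (kappa p)%:C *
  besselI_even nu ((alpha / 2)%:C * (sqrtc z * ((sqrtc (toC p))^*)%R)).

Lemma bessel_partialE N p : bessel_partial N p =
  monomial 0 p * (kappa p)%:C * \sum_(k < N) bessel_arg p ^+ k * (besselI_coef nu k)%:C.
Proof.
rewrite big_distrr; apply: eq_bigr => k _.
have -> : (q ^+ k * besselI_coef nu k)%:C = q%:C ^+ k * (besselI_coef nu k)%:C :> R[i].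
  by rewrite -rmorphXn -rmorphM.
rewrite /bessel_arg /monomial expr0 !exprMn /=; ring.
Qed.

Lemma ccvg_bessel_partial p : ccvg (fun N => bessel_partial N p) (bessel_limit p).
Proof.
under eq_fun do rewrite bessel_partialE.
apply: ccvgZ; apply: (ccvg_besselI_even nu1).
rewrite /bessel_arg /q; set s := sqrtc (toC p).
have hs : (s^*)%R ^+ 2 = p.1 -i* p.2 by rewrite -rmorphXn /= sqr_sqrtc conjE.
have -> : (alpha / 2)%:C * (sqrtc z * (s^*)%R) / 2 = (alpha / 4)%:C * (sqrtc z * (s^*)%R).
  have -> : (alpha / 4)%:C = (alpha / 2)%:C / 2 :> R[i].
    rewrite (_ : alpha / 4 = alpha / 2 / 2); last by field.
    by rewrite (rmorphM _ (alpha / 2)) fmorphV rmorph_nat.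
  by rewrite mulrAC.
by rewrite 2!exprMn sqr_sqrtc hs -rmorphXn.
Qed.

Let kappa0 p : 0 <= kappa p.
Proof. by apply: weight_margin_ge0 => pt; exact: besselK_kernel_ge0. Qed.

Lemma bessel_partial_bound : exists C : R, forall N p,
  cabs (bessel_partial N p) <= C * (expR (2 * alpha / 9 * cabs (toC p)) * kappa p).
Proof.
have a36 : 0 < alpha / 36 by rewrite divr_gt0.
have z1 : 0 < cabs z + 1 by rewrite ltr_wpDl// normc_ge0.
(* With this [D] the bound [expR (x / D)] at [x = q |z| r] has rate at most [alpha / 36] in [r]; the
   [+ 1] keeps [D] positive at [z = 0]. *)
pose D := q * (cabs z + 1) / (alpha / 36).
have D0 : 0 < D by rewrite divr_gt0// mulr_gt0.
have [M [M0 HM]] := besselI_sum_le nu1 D0.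
pose c := (n + 0)`!%:R / (alpha / 36) ^+ (n + 0).
exists (c * M) => N p; set r := cabs (toC p).
have r0 : 0 <= r by exact: normc_ge0.
rewrite bessel_partialE 2!ComplexField.Normc.normcM (cabs_real (kappa0 p)).
set S := cabs (\sum_(k < N) _).
have ax : cabs (bessel_arg p) = q * (cabs z * r).
  by rewrite /bessel_arg !ComplexField.Normc.normcM cabs_real ?normc_conj// ltW.
have Sle : S <= M * expR (alpha / 36 * r).
  apply: (@le_trans _ _ (\sum_(k < N) cabs (bessel_arg p) ^+ k * besselI_coef nu k)).
    apply: (le_trans (normc_sum N (fun k => bessel_arg p ^+ k * (besselI_coef nu k)%:C))); apply: ler_sum => k _.
    by rewrite ComplexField.Normc.normcM normcX cabs_real// ltW// besselI_coef_gt0.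
  apply: (le_trans (HM _ N (normc_ge0 _))).
  rewrite ler_wpM2l ?(ltW M0)// ler_expR ax ler_pdivrMr// /D.
  rewrite (_ : alpha / 36 * r * (q * (cabs z + 1) / (alpha / 36)) = q * ((cabs z + 1) * r)).
    by rewrite ler_wpM2l ?(ltW q0)// ler_wpM2r// lerDl.
  by field; rewrite gt_eqF.
have mle := normc_monomial_le 0 p a36.
have S0 : 0 <= S by exact: normc_ge0.
have := ler_pM (normc_ge0 _) S0 mle Sle; rewrite -/r -/c => H.
rewrite [leLHS]mulrAC.
apply: (le_trans (ler_wpM2r (kappa0 p) H)).
rewrite (_ : 2 * alpha / 9 * r = (alpha / 36 + alpha / 6) * r + alpha / 36 * r); last by field.
rewrite expRD le_eqVlt; apply/orP; left; apply/eqP; ring.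
Qed.

(** Termwise integration by dominated convergence. The dominating function is a margin of
    [e^(2 alpha |u| / 9)] times the kernel, hence inherits integrability from the product space. *)
Lemma cint_bessel_limit : cint_able pm bessel_limit /\
  ccvg (fun N => \sum_(k < N) ((q ^+ k * besselI_coef nu k)%:C * z ^+ k) *
    (theta_moment alpha nu n k)%:C) (cint pm bessel_limit).
Proof.
have [C HC] := bessel_partial_bound.
have Wi := integrable_besselK_kernel alpha0 nu1.
have W0 := besselK_kernel_ge0 alpha nu.
have mexp : measurable_fun setT (fun p => expR (2 * alpha / 9 * cabs (toC p))).
  apply: measurableT_comp; first exact: measurable_expR.
  by apply: measurable_funM => //; exact: measurable_normc_toC.
have gi := integrable_weight_margin W0 Wi mexp (integrable_exp_kernel alpha0 nu1).
have gCi := @integrableZl _ _ _ pm setT measurableT C _ gi.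
pose F k p := ((q ^+ k * besselI_coef nu k)%:C * z ^+ k) * (monomial k p * (kappa p)%:C).
have Fi k : cint_able pm (F k).
  by apply: cint_ableZ; exact: (cint_monomial k).1.
have Fs N : cint_able pm (bessel_partial N) by exact: (@cint_able_sum _ _ _ pm N F Fi).
have [i l] := cint_dominated Fs ccvg_bessel_partial HC gCi.
split=> //; move: l; congr (ccvg _ _); apply/funext => N.
rewrite (@cint_sum _ _ _ pm N F Fi); apply: eq_bigr => k _; rewrite /F.
by rewrite cintZ ?(cint_monomial k).2//; exact: (cint_monomial k).1.
Qed.

Definition bessel_integral : R[i] :=
     ((-1) ^+ n * 3 * pi * 2 `^ (nu + 3) * 4 ^+ n * n`!%:R
        / alpha ^+ (n + 2))%:C
     * cexp (- (alpha%:C * z / 4))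
     * laguerre n nu (alpha%:C * z).

(** Up to the constant, the termwise integrals are the terms of the Laguerre series, so both sides
    are limits of one sequence. *)
Lemma cint_bessel_limitE :
  (2^-1 * (3 / 2) `^ nu)%:C * cint pm bessel_limit = bessel_integral.
Proof.
have [_ l] := cint_bessel_limit.
have := ccvgZ (2^-1 * (3 / 2) `^ nu)%:C l.
under eq_fun do rewrite big_distrr.
move=> H; apply: (ccvg_unique H); have := ccvg_series_coef n alpha0 nu1 z.
congr (ccvg _ _); apply/funext => N; apply: eq_bigr => k _.
rewrite /series_coef -/q !rmorphM /=; ring.
Qed.

Definition reduced_integrand (u : R[i]) : R[i] :=
  cpow u (n%:R + nu / 2)
  * (cpow ((alpha / 4)%:C * (sqrtc u)^*) nu
     * besselI_even nu ((alpha / 2)%:C * (sqrtc z * (sqrtc u)^*)))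
  * (expR (- (1 / 6) * alpha * complex.Re u)
      * besselK nu (alpha * ComplexField.Normc.normc u / 3))%:C.

(* The origin is excluded because of the junk values of [cpow] and [besselK]
   there. *)
Lemma reduced_integrandE p : p != (0, 0) ->
  reduced_integrand (toC p) = (2^-1 * (3 / 2) `^ nu)%:C * bessel_limit p.
Proof.
move=> p0.
have u0 : toC p != 0.
  apply: contra p0; case: p => a b; rewrite /toC eq_complex /=.
  by move=> /andP[/eqP -> /eqP ->].
have a4 : 0 < alpha / 4 by rewrite divr_gt0.
have h1 := cpow_u_besselI_arg nu n a4 u0.
have h2 := besselK_marginE nu alpha0 u0.
have h3 : (alpha / 4) `^ nu * ((alpha / 3) `^ (- nu) * (2 `^ nu / 2)) = 2^-1 * (3 / 2) `^ nu.
  have a3 : 0 < alpha / 3 by rewrite divr_gt0.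
  have e : alpha / 4 * 2 = alpha / 3 * (3 / 2) by field.
  have := congr1 (fun t => t `^ nu) e.
  rewrite (powRM nu (ltW a4) (ler0n _ 2)) (powRM nu (ltW a3) (divr_ge0 (ler0n _ 3) (ler0n _ 2))) => h.
  rewrite powRN; have a3n : (alpha / 3) `^ nu != 0 by rewrite gt_eqF// powR_gt0.
  apply: (mulfI a3n); rewrite [RHS]mulrCA -h; field.
  by rewrite a3n.
have dE : expR (- (1 / 6) * alpha * complex.Re (toC p)) = decay p by [].
rewrite /reduced_integrand /bessel_limit /monomial dE expr0 -h3.
set b := besselI_even _ _.
rewrite [LHS](_ : _ = (cpow (toC p) (n%:R + nu / 2) * cpow ((alpha / 4)%:C * ((sqrtc (toC p))^*)%R) nu) *
  b * (decay p)%:C * (besselK nu (alpha * cabs (toC p) / 3))%:C); last by rewrite rmorphM /=; ring.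
rewrite h1.
have h2' : (cabs (toC p) `^ nu)%:C * (besselK nu (alpha * cabs (toC p) / 3))%:C =
  ((alpha / 3) `^ (- nu) * (2 `^ nu / 2) * kappa p)%:C.
  rewrite -rmorphM /= h2; congr ((_ * kappa _)%:C); by case: (p).
transitivity (((alpha / 4) `^ nu)%:C * ((cabs (toC p) `^ nu)%:C * (besselK nu (alpha * cabs (toC p) / 3))%:C) * (toC p) ^+ n * b * (decay p)%:C).
  by rewrite rmorphM /=; ring.
rewrite h2' !(rmorphM, mul1r) /=; ring.
Qed.

(** The origin is a null set, so the pointwise identity away from it suffices. *)
Lemma cint_reduced_integrand :
  cintegrable reduced_integrand /\ cintegral reduced_integrand = bessel_integral.
Proof.
have [i _] := cint_bessel_limit.
have iZ := cint_ableZ (2^-1 * (3 / 2) `^ nu)%:C i.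
have m0 : measurable [set ((0, 0) : plane)].
  rewrite (_ : [set _] = [set 0 : measurableTypeR R] `*` [set 0 : measurableTypeR R]).
    by apply: measurableX; exact: measurable_set1.
  by apply/seteqP; split => [_ ->//|[a b] /= [-> ->]].
have [H1 H2] := cint_ae m0 (plane_measure1 (0, 0)) reduced_integrandE iZ.
split; first exact: H1.
by rewrite -cint_bessel_limitE -cintZ.
Qed.

End BesselLaguerreIntegral.

Theorem mainTheorem6 (R : realType) (alpha nu : R) (n : nat)
    (halpha : 0 < alpha) (hnu : -1 < nu) (z : R[i]) :
  (* the identity, with principal roots and powers *)
  (let F := fun u : R[i] =>
     cpow u (n%:R + nu / 2)
     * besselI nu ((alpha / 2)%:C * (sqrtc z * (sqrtc u)^*))
     * (expR (- (1 / 6) * alpha * complex.Re u) 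
         * besselK nu (alpha * ComplexField.Normc.normc u / 3))%:C in
   cintegrable F /\
   cintegral F =
     ((-1) ^+ n * 3 * pi * 2 `^ (nu + 3) * 4 ^+ n * n`!%:R
        / alpha ^+ (n + 2))%:C
     * cpow z (nu / 2) * cexp (- (alpha%:C * z / 4))
     * laguerre n nu (alpha%:C * z))
  /\
  (* the same identity after cancelling z^(nu/2) *)
  (let G := fun u : R[i] =>
     cpow u (n%:R + nu / 2)
     * (cpow ((alpha / 4)%:C * (sqrtc u)^*) nu
        * besselI_even nu ((alpha / 2)%:C * (sqrtc z * (sqrtc u)^*)))
     * (expR (- (1 / 6) * alpha * complex.Re u) 
         * besselK nu (alpha * ComplexField.Normc.normc u / 3))%:C in
   cintegrable G /\
   cintegral G =
     ((-1) ^+ n * 3 * pi * 2 `^ (nu + 3) * 4 ^+ n * n`!%:R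
        / alpha ^+ (n + 2))%:C
     * cexp (- (alpha%:C * z / 4))
     * laguerre n nu (alpha%:C * z)).
Proof.
have [Gi GE] := cint_reduced_integrand n halpha hnu z.
split; last by split; [exact: Gi|exact: GE].
move=> F.
(* The identity with principal powers is [z^(nu / 2)] times the cancelled one, for every [u], zero
   included. *)
have FE : F = (fun u => cpow z (nu / 2) * reduced_integrand alpha nu n z u).
  apply/funext => u; rewrite /F /reduced_integrand /besselI.
  have a4 : 0 < alpha / 4 by rewrite divr_gt0.
  have -> : (alpha / 2)%:C * (sqrtc z * ((sqrtc u)^*)%R) / 2 =
      (alpha / 4)%:C * (sqrtc z * ((sqrtc u)^*)%R).
    have -> : (alpha / 4)%:C = (alpha / 2)%:C / 2 :> R[i].
      rewrite (_ : alpha / 4 = alpha / 2 / 2); last by field.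
      by rewrite (rmorphM _ (alpha / 2)) fmorphV rmorph_nat.
    by rewrite mulrAC.
  rewrite (cpow_besselI_arg nu z u a4); ring.
rewrite FE; split; first exact: (@cint_ableZ _ _ _ (@plane_measure R) _ _ Gi).
(* [cintegral] is [cint] over [plane_measure] by unfolding. *)
transitivity (cint (@plane_measure R)
    (fun p => cpow z (nu / 2) * reduced_integrand alpha nu n z (toC p))); first by [].
rewrite cintZ; last exact: Gi.
rewrite [cint _ _]GE /bessel_integral; ring.
Qed.
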